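(* Let $n \in \{1,2\}$. Then every graph in the $\mathrm{Y}\nabla\mathrm{Y}$ family of $K_{n+5}$ and every graph in the $\mathrm{Y}\nabla\mathrm{Y}$ family of $K_{3^2,1^n}$ belongs to $\mathcal{O}_n$; that is, each such graph is not $n$-apex, while every proper minor of it is $n$-apex.
   Context: All graphs are finite. A graph is $n$-apex if deleting $n$ or fewer of its vertices can result in a planar graph ($0$-apex means planar). $H$ is a minor of $G$ if $H$ can be obtained by contracting edges in a subgraph of $G$. $\mathcal{O}_n$ is the set of graphs that are not $n$-apex even though every proper minor is $n$-apex (minor minimal not $n$-apex graphs). $K_{n+5}$ is the complete graph on $n+5$ vertices. $K_{3^2,1^n}$ is the complete multipartite graph with two parts of three vertices each and $n$ further parts each having a single vertex. A $\nabla\mathrm{Y}$ (triangle-Y) move on a graph deletes the three edges of a triangle $abc$ and then adds a new vertex $v$ together with the edges $av$, $bv$, $cv$. The reverse operation is a $\mathrm{Y}\nabla$ (Y-triangle) move: a degree-three vertex $v$ with neighbors $a,b,c$ is deleted and the edges $ab$, $ac$, $bc$ are added. The $\mathrm{Y}\nabla\mathrm{Y}$ family of a graph $G$ is the set of all graphs obtained from $G$ by a sequence of zero or more $\nabla\mathrm{Y}$ or $\mathrm{Y}\nabla$ moves. *)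

(* Defs.v *)
From HB Require Import structures.
From mathcomp Require Import all_boot all_order all_algebra.
From mathcomp Require Import all_classical all_reals all_analysis.

Set Implicit Arguments.
Unset Strict Implicit.
Unset Printing Implicit Defensive.

Import Order.TTheory GRing.Theory Num.Theory numFieldNormedType.Exports.

(* Finite simple graphs.  Parallel edges produced by a contraction or by a
   Y-to-triangle move are identified and loops are discarded. *)
Record sgraph := SGraph {
  vert :> finType;
  adj : rel vert;
  adj_sym : symmetric adj;
  adj_irr : irreflexive adj }.

Definition iso (G H : sgraph) : Prop :=
  exists f : G -> H, bijective f /\ forall x y, adj (f x) (f y) = adj x y.

Definition subgraph (H G : sgraph) : Prop :=
  exists f : H -> G, injective f /\ forall x y, adj x y -> adj (f x) (f y).

Section Delete.
Variables (G : sgraph) (X : {set G}).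

Definition del_vert : finType := {x : G | x \notin X}.
Definition del_adj : rel del_vert := fun x y => adj (val x) (val y).

Fact del_sym : symmetric del_adj.
Proof. by move=> x y; exact: adj_sym. Qed.

Fact del_irr : irreflexive del_adj.
Proof. by move=> x; exact: adj_irr. Qed.

Definition del : sgraph := SGraph del_sym del_irr.
End Delete.

(* Contraction of the edge uv; the merged vertex keeps the name u. *)
Section Contract.
Variables (G : sgraph) (u v : G).

Definition contract_vert : finType := {x : G | x != v}.
Definition contract_adj : rel contract_vert := fun x y =>
  (x != y) && [|| adj (val x) (val y),
                  (val x == u) && adj v (val y)
                | (val y == u) && adj v (val x)].

Fact contract_sym : symmetric contract_adj.
Proof.
move=> x y; rewrite /contract_adj eq_sym adj_sym.
by congr (_ && (_ || _)); rewrite orbC.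
Qed.

Fact contract_irr : irreflexive contract_adj.
Proof. by move=> x; rewrite /contract_adj eqxx. Qed.

Definition contract : sgraph := SGraph contract_sym contract_irr.
End Contract.

(* None is the vertex added by the triangle-to-Y move. *)
Section TriangleY.
Variables (G : sgraph) (a b c : G).

Definition triY_adj : rel (option G) := fun x y =>
  match x, y with
  | Some x, Some y =>
      adj x y && ~~ ((x \in [set a; b; c]) && (y \in [set a; b; c]))
  | Some x, None => x \in [set a; b; c]
  | None, Some y => y \in [set a; b; c]
  | None, None => false
  end.

Fact triY_sym : symmetric triY_adj.
Proof. by move=> [x|] [y|] //=; rewrite adj_sym; congr (_ && ~~ _); exact: andbC. Qed.

Fact triY_irr : irreflexive triY_adj.
Proof. by move=> [x|] //=; rewrite adj_irr. Qed.

Definition triY : sgraph := @SGraph (option G) triY_adj triY_sym triY_irr.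
End TriangleY.

Section YTriangle.
Variables (G : sgraph) (v : G).

Definition Ytri_vert : finType := {x : G | x != v}.
Definition Ytri_adj : rel Ytri_vert := fun x y =>
  adj (val x) (val y) || [&& x != y, adj v (val x) & adj v (val y)].

Fact Ytri_sym : symmetric Ytri_adj.
Proof.
move=> x y; rewrite /Ytri_adj adj_sym eq_sym.
by congr (_ || (_ && _)); exact: andbC.
Qed.

Fact Ytri_irr : irreflexive Ytri_adj.
Proof. by move=> x; rewrite /Ytri_adj adj_irr eqxx. Qed.

Definition Ytri : sgraph := SGraph Ytri_sym Ytri_irr.
End YTriangle.

(* Graphs obtained from G, up to isomorphism, by zero or more steps. *)
Inductive reach (step : sgraph -> sgraph -> Prop) (G : sgraph) : sgraph -> Prop :=
| reach_iso H : iso G H -> reach step G H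
| reach_step H K L : reach step G H -> step H K -> iso K L -> reach step G L.

Inductive contract_step (G : sgraph) : sgraph -> Prop :=
| ContractStep (u v : G) : adj u v -> contract_step G (contract u v).

Inductive YDY_move (G : sgraph) : sgraph -> Prop :=
| TriYMove (a b c : G) :
    adj a b -> adj b c -> adj a c -> YDY_move G (triY a b c)
| YTriMove (v : G) : #|[set x | adj v x]| = 3 -> YDY_move G (Ytri v).

Definition YDY_family (G H : sgraph) : Prop := reach YDY_move G H.

Definition is_minor (H G : sgraph) : Prop :=
  exists S : sgraph, subgraph S G /\ reach contract_step S H.

(* By finiteness, a minor is isomorphic to G only if no deletion and no
   contraction was performed. *)
Definition proper_minor (H G : sgraph) : Prop := is_minor H G /\ ~ iso H G.

Local Open Scope classical_set_scope.
Local Open Scope ring_scope.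

(* A drawing of G in the plane without crossings: vertices are distinct points
   and edges are simple arcs.  The arc of an edge occurs twice, once for each
   orientation. *)
Definition planar (R : realType) (G : sgraph) : Prop :=
  exists (pt : G -> R * R) (arc : G -> G -> R -> R * R),
  [/\ injective pt,
      forall u v, adj u v ->
        [/\ {within `[0, 1], continuous (arc u v)},
            {in `[0, 1] &, injective (arc u v)},
            arc u v 0 = pt u,
            arc u v 1 = pt v
          & forall t : R, t \in `[0, 1] -> arc v u t = arc u v (1 - t)],
      forall u v w (t : R), adj u v -> t \in `]0, 1[ -> arc u v t <> pt w
    & forall u v x y (s t : R), adj u v -> adj x y ->
        [set u; v]%SET <> [set x; y]%SET ->
        s \in `]0, 1[ -> t \in `]0, 1[ -> arc u v s <> arc x y t].

Definition n_apex (R : realType) (n : nat) (G : sgraph) : Prop :=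
  exists X : {set G}, (#|X| <= n)%N /\ planar R (del X).

(* The class O_n. *)
Definition minor_minimal_not_apex (R : realType) (n : nat) (G : sgraph) : Prop :=
  ~ n_apex R n G /\ forall H, proper_minor H G -> n_apex R n H.

Section CompleteMultipartite.
(* s lists the sizes of the parts; a vertex is a part together with an index
   in that part. *)
Variable s : seq nat.

Definition multipartite_vert : finType :=
  {i : 'I_(size s) & 'I_(tnth (in_tuple s) i)}.
Definition multipartite_adj : rel multipartite_vert :=
  fun x y => tag x != tag y.

Fact multipartite_sym : symmetric multipartite_adj.
Proof. by move=> x y; exact: (congr1 negb (eq_sym _ _)). Qed.

Fact multipartite_irr : irreflexive multipartite_adj.
Proof. by move=> x; rewrite /multipartite_adj eqxx. Qed.

Definition complete_multipartite : sgraph :=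
  SGraph multipartite_sym multipartite_irr.
End CompleteMultipartite.

Section Complete.
Variable n : nat.

Definition complete_adj : rel 'I_n := fun x y => x != y.

Fact complete_sym : symmetric complete_adj.
Proof. by move=> x y; exact: (congr1 negb (eq_sym _ _)). Qed.

Fact complete_irr : irreflexive complete_adj.
Proof. by move=> x; rewrite /complete_adj eqxx. Qed.

Definition complete : sgraph := @SGraph 'I_n complete_adj complete_sym complete_irr.
End Complete.

(* Main.v *)
Require Import Defs.
From mathcomp Require Import all_boot all_order all_algebra.
From mathcomp Require Import all_classical all_reals all_analysis.
From mathcomp Require Import zify ring lra.

(** The YDY families involved are finite: 7 graphs for K_6 and for K_{3,3,1},
    20 for K_7 and 58 for K_{3,3,1,1}.  They are generated by closing the
    starting graph under the two moves up to isomorphism, and each member is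
    then shown to be an obstruction_check.  What makes this possible is that both
    halves of the claim reduce to combinatorial tests which are sound for
    drawings by arbitrary continuous arcs.

    Not n-apex.  A drawing yields, for every vertex w and edge e avoiding w, the
    parity of the number of times that the direction from w to a point running
    along e crosses the positive horizontal axis.  Two disjoint edges e and f
    give a map (s, t) |-> e(s) - f(t) from a square to the punctured plane, and
    the total parity around the boundary of the square vanishes; this is a
    linear equation over the two-element field between the four parities
    attached to the ends of e and f ([planar_z2planar]).  Solvability of the
    resulting system, called [z2planar], is inherited by minors, for the parity
    of a contracted edge followed by another edge is a sum
    ([z2planar_contract]), and adding suitable equations shows that K_5 and
    K_{3,3} have no solution.  This replaces the Jordan curve theorem.  A
    search then finds one of these two minors whenever n vertices are deleted
    from a member of the family.

    Minimality.  A proper minor is a minor of the graph with one edge deleted or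
    contracted ([minor_step]).  For almost all of these graphs, deleting n + 1
    suitable vertices leaves an outerplanar graph, that is, a graph whose
    vertices can be placed on a line so that the edges, drawn as half-circles
    above the line, do not cross.  This property passes to all minors
    ([near_outerplanar_contract]), and it implies n-apexness: restore one of
    the n + 1 vertices as the first vertex of the line, with its edges drawn
    below ([near_outerplanar_apex], [book_planar]).  The only exception is
    K_{3,3,2}, which occurs for n = 2; deleting two of its vertices leaves an
    octahedron, drawn with edges on both sides of the line, and its own
    one-step minors are again near-outerplanar ([mK332_minors_apex]). *)

Set Implicit Arguments.
Unset Strict Implicit.
Unset Printing Implicit Defensive.

Import Order.TTheory GRing.Theory Num.Theory numFieldNormedType.Exports.

(* [contract] is also an operation on the extended reals *)
Notation contract := Defs.contract.
Implicit Types G H K S : sgraph.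

(** * Planarity modulo two *)

(** Think of the vertices as points in the plane: [k w u v] is the parity of the
    number of times that a point going from u to v along the edge uv crosses
    the horizontal ray to the right of w, and [h u w] says that u is above w.
    Running along uv and xy independently gives the equation; the right-hand
    side appears because [k u x y] looks from u to xy and not from xy to u. *)
Definition z2planar (T : eqType) (a : rel T) : Prop :=
  exists (k : T -> T -> T -> bool) (h : rel T),
  (forall u w, u != w -> h u w = ~~ h w u) /\
  forall u v x y, a u v -> a x y ->
    x != u -> x != v -> y != u -> y != v ->
    k x u v (+) k y u v (+) (k u x y (+) k v x y)
      = h x u (+) h y u (+) (h x v (+) h y v).

Lemma z2planar_sub (T : eqType) (a b : rel T) : subrel b a ->
  z2planar a -> z2planar b.
Proof.
move=> ba [k [h [hA hk]]]; exists k, h; split=> // u v x y /ba uv /ba xy.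
exact: hk.
Qed.

Lemma addb_chain (k1 k2 c1 c2 c3 h1 h2 h3 : bool) :
  k1 (+) (c1 (+) c2) = h1 (+) h2 -> k2 (+) (c2 (+) c3) = h2 (+) h3 ->
  k1 (+) k2 (+) (c1 (+) c3) = h1 (+) h3.
Proof. by case: k1 k2 c1 c2 c3 h1 h2 h3 => [] [] [] [] [] [] [] []. Qed.

(** An edge uy of the contraction comes from uy or from vy.  In the second case
    it is represented by the path u, v, y: its parity is the sum of those of
    uv and vy, and the equation for uy is the sum of their equations. *)
Lemma z2planar_contract (T : eqType) (a b : rel T) (u v : T) : a u v -> symmetric a ->
  (forall x y, b x y -> [/\ x != y, x != v, y != v &
     [\/ a x y, x = u /\ a v y | y = u /\ a v x]]) ->
  z2planar a -> z2planar b.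
Proof.
move=> uv a_sym hb [k [h [hA hk]]].
pose k' w x y := if a x y then k w x y else
  if x == u then k w u v (+) k w v y else k w x v (+) k w v u.
exists k', h; split=> //.
have vu : a v u by rewrite a_sym.
have once x y z w : b x y -> a z w -> z != x -> z != y -> w != x -> w != y ->
    z != v -> w != v ->
    k' z x y (+) k' w x y (+) (k x z w (+) k y z w)
      = h z x (+) h w x (+) (h z y (+) h w y).
  move=> /hb[xy xv yv ab] zw zx zy wx wy zv wv; rewrite /k'.
  case: ifPn => [axy|naxy]; first exact: hk.
  case: ab => [|[xu vy]|[yu vx]]; first by rewrite (negbTE naxy).
    subst x; rewrite eqxx.
    have e1 := hk _ _ _ _ uv zw zx zv wx wv.
    have e2 := hk _ _ _ _ vy zw zv zy wv wy.
    rewrite (addbACA (k z u v)); exact: addb_chain e1 e2.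
  subst y; rewrite (negbTE xy).
  have xv' : a x v by rewrite a_sym.
  have e1 := hk _ _ _ _ xv' zw zx zv wx wv.
  have e2 := hk _ _ _ _ vu zw zv zy wv wy.
  rewrite (addbACA (k z x v)); exact: addb_chain e1 e2.
move=> x y z w xy zw zx zy wx wy.
have [xney xv yv ab] := hb _ _ xy; have [znew zv wv cd] := hb _ _ zw.
have [azw|nzw] := boolP (a z w).
  have kE r : k' r z w = k r z w by rewrite /k' azw.
  by rewrite !kE; exact: once.
(* only one of two disjoint edges ends at u *)
have axy : a x y.
  have nuzw : z = u \/ w = u.
    by case: cd => [|[-> _]|[-> _]]; [rewrite (negbTE nzw)|left|right].
  case: ab => [//|[xu _]|[yu _]].
    by case: nuzw => e; [move: zx|move: wx]; rewrite e xu eqxx.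
  by case: nuzw => e; [move: zy|move: wy]; rewrite e yu eqxx.
have xz : x != z by rewrite eq_sym.
have xw : x != w by rewrite eq_sym.
have yz : y != z by rewrite eq_sym.
have yw : y != w by rewrite eq_sym.
have := once z w x y zw axy xz xw yz yw xv yv.
have kE r : k' r x y = k r x y by rewrite /k' axy.
rewrite !kE.
rewrite (hA z x) // (hA z y) // (hA w x) // (hA w y) //.
move: (k' x z w) (k' y z w) (k z x y) (k w x y).
by move: (h x z) (h y z) (h x w) (h y w); do 8!case.
Qed.

Section Kuratowski.
Variables (T : eqType) (a : rel T) (f : nat -> T) (n : nat).
Hypothesis f_inj : {in gtn n &, injective f}.

(** Integer form of the equations on finitely many named vertices, in which
    infeasibility is a matter of linear integer arithmetic. *)
Lemma z2planar_int : z2planar a ->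
  exists (k : nat -> nat -> nat -> int) (h : nat -> nat -> int),
  (forall i j, i < n -> j < n -> i != j -> (h i j + h j i = 1)%R) /\
  forall i j p q, a (f i) (f j) -> a (f p) (f q) ->
    all (gtn n) [:: i; j; p; q] -> uniq [:: i; j; p; q] -> exists m,
    (k p i j + k q i j + k i p q + k j p q
     = h p i + h q i + h p j + h q j + 2 * m)%R.
Proof.
move=> [k [h [hA hk]]].
exists (fun w u v => Posz (k (f w) (f u) (f v))).
exists (fun u w => Posz (h (f u) (f w))); split.
  move=> i j hi hj ij; rewrite hA; first by case: (h _ _).
  by apply: contra ij => /eqP /f_inj ->; rewrite ?inE.
move=> i j p q ij pq /and5P[hi hj hp hq _] /=.
rewrite !inE !negb_or !andbT -!andbA => /and5P[_ ip iq jp /andP[jq _]].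
have ne u w : u < n -> w < n -> u != w -> f w != f u.
  by move=> hu hw; apply: contra => /eqP /f_inj ->; rewrite ?inE.
have := hk _ _ _ _ ij pq (ne _ _ hi hp ip) (ne _ _ hj hp jp) (ne _ _ hi hq iq)
  (ne _ _ hj hq jq).
set b := (X in X = _); set c := (X in _ = X) => bc.
pose A := (k (f p) (f i) (f j) + k (f q) (f i) (f j)
           + (k (f i) (f p) (f q) + k (f j) (f p) (f q)))%N.
pose B := (h (f p) (f i) + h (f q) (f i) + (h (f p) (f j) + h (f q) (f j)))%N.
have oA : odd A = b by rewrite /A !oddD !oddb.
have oB : odd B = b by rewrite /B bc !oddD !oddb.
exists (Posz A./2 - Posz B./2)%R.
have := odd_double_half A; have := odd_double_half B; rewrite oA oB -!mul2n.
rewrite /A /B; move: (nat_of_bool b).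
do 4!move: (nat_of_bool (k _ _ _)); do 4!move: (nat_of_bool (h _ _)).
by clear; lia.
Qed.

End Kuratowski.

(** Sum the equations of the 18 pairs of disjoint edges: each parity occurs twice,
    while the comparisons of heights add up to an odd number. *)
Lemma K33_not_z2planar (T : eqType) (a : rel T) (f : nat -> T) :
  {in gtn 6 &, injective f} ->
  (forall i j, i < 3 -> 2 < j < 6 -> a (f i) (f j)) -> ~ z2planar a.
Proof.
move=> fi fa /(z2planar_int fi)[k [h [hA hk]]].
have E i j p q : i < 3 -> 2 < j < 6 -> p < 3 -> 2 < q < 6 ->
    all (gtn 6) [:: i; j; p; q] -> uniq [:: i; j; p; q] -> _ :=
  fun hi hj hp hq => hk i j p q (fa i j hi hj) (fa p q hp hq).
have [? ?] := E 0 3 1 4 isT isT isT isT isT isT.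
have [? ?] := E 0 3 1 5 isT isT isT isT isT isT.
have [? ?] := E 0 4 1 3 isT isT isT isT isT isT.
have [? ?] := E 0 4 1 5 isT isT isT isT isT isT.
have [? ?] := E 0 5 1 3 isT isT isT isT isT isT.
have [? ?] := E 0 5 1 4 isT isT isT isT isT isT.
have [? ?] := E 0 3 2 4 isT isT isT isT isT isT.
have [? ?] := E 0 3 2 5 isT isT isT isT isT isT.
have [? ?] := E 0 4 2 3 isT isT isT isT isT isT.
have [? ?] := E 0 4 2 5 isT isT isT isT isT isT.
have [? ?] := E 0 5 2 3 isT isT isT isT isT isT.
have [? ?] := E 0 5 2 4 isT isT isT isT isT isT.
have [? ?] := E 1 3 2 4 isT isT isT isT isT isT.
have [? ?] := E 1 3 2 5 isT isT isT isT isT isT.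
have [? ?] := E 1 4 2 3 isT isT isT isT isT isT.
have [? ?] := E 1 4 2 5 isT isT isT isT isT isT.
have [? ?] := E 1 5 2 3 isT isT isT isT isT isT.
have [? ?] := E 1 5 2 4 isT isT isT isT isT isT.
have ? := hA 0 1 isT isT isT.
have ? := hA 0 2 isT isT isT.
have ? := hA 0 3 isT isT isT.
have ? := hA 0 4 isT isT isT.
have ? := hA 0 5 isT isT isT.
have ? := hA 1 2 isT isT isT.
have ? := hA 1 3 isT isT isT.
have ? := hA 1 4 isT isT isT.
have ? := hA 1 5 isT isT isT.
have ? := hA 2 3 isT isT isT.
have ? := hA 2 4 isT isT isT.
have ? := hA 2 5 isT isT isT.
have ? := hA 3 4 isT isT isT.
have ? := hA 3 5 isT isT isT.
have ? := hA 4 5 isT isT isT.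
clear E fi fa hk hA; lia.
Qed.

(** Here there are 15 pairs of disjoint edges. *)
Lemma K5_not_z2planar (T : eqType) (a : rel T) (f : nat -> T) :
  {in gtn 5 &, injective f} ->
  (forall i j, i < 5 -> j < 5 -> i != j -> a (f i) (f j)) -> ~ z2planar a.
Proof.
move=> fi fa /(z2planar_int fi)[k [h [hA hk]]].
have E i j p q : i < 5 -> j < 5 -> i != j -> p < 5 -> q < 5 -> p != q ->
    all (gtn 5) [:: i; j; p; q] -> uniq [:: i; j; p; q] -> _ :=
  fun hi hj ij hp hq pq => hk i j p q (fa i j hi hj ij) (fa p q hp hq pq).
have [? ?] := E 0 1 2 3 isT isT isT isT isT isT isT isT.
have [? ?] := E 0 1 2 4 isT isT isT isT isT isT isT isT.
have [? ?] := E 0 1 3 4 isT isT isT isT isT isT isT isT.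
have [? ?] := E 0 2 1 3 isT isT isT isT isT isT isT isT.
have [? ?] := E 0 2 1 4 isT isT isT isT isT isT isT isT.
have [? ?] := E 0 2 3 4 isT isT isT isT isT isT isT isT.
have [? ?] := E 0 3 1 2 isT isT isT isT isT isT isT isT.
have [? ?] := E 0 3 1 4 isT isT isT isT isT isT isT isT.
have [? ?] := E 0 3 2 4 isT isT isT isT isT isT isT isT.
have [? ?] := E 0 4 1 2 isT isT isT isT isT isT isT isT.
have [? ?] := E 0 4 1 3 isT isT isT isT isT isT isT isT.
have [? ?] := E 0 4 2 3 isT isT isT isT isT isT isT isT.
have [? ?] := E 1 2 3 4 isT isT isT isT isT isT isT isT.
have [? ?] := E 1 3 2 4 isT isT isT isT isT isT isT isT.
have [? ?] := E 1 4 2 3 isT isT isT isT isT isT isT isT.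
have ? := hA 0 1 isT isT isT.
have ? := hA 0 2 isT isT isT.
have ? := hA 0 3 isT isT isT.
have ? := hA 0 4 isT isT isT.
have ? := hA 1 2 isT isT isT.
have ? := hA 1 3 isT isT isT.
have ? := hA 1 4 isT isT isT.
have ? := hA 2 3 isT isT isT.
have ? := hA 2 4 isT isT isT.
have ? := hA 3 4 isT isT isT.
clear E fi fa hk hA; lia.
Qed.

(** * Drawings are planar modulo two *)

Section Winding.
Variable R : realType.
Local Open Scope ring_scope.
Implicit Types (p q : R * R) (d : R).

(** The tie-breaking for horizontal directions makes exactly one of p and - p upper
    when p is not the origin, see [upper_opp]. *)
Definition upper p : bool := (0 < p.2) || ((p.2 == 0) && (0 < p.1)).

(** For p and q close to each other and far from the origin, whether the step from p to
    q crosses the positive horizontal axis. *)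
Definition cross p q : bool := (upper p (+) upper q) && (0 < p.1).

Definition far d p := (d <= `|p.1|) || (d <= `|p.2|).

Definition close d p q := (`|p.1 - q.1| < d / 2) && (`|p.2 - q.2| < d / 2).

Lemma upper_change_axis d p q : upper p != upper q -> close d p q ->
  `|p.2| < d / 2.
Proof.
rewrite /upper /close => + /andP[_]; rewrite !ltr_norml.
case: (ltrgtP 0 p.2) => hp; case: (ltrgtP 0 q.2) => hq //= _ /andP[? ?]; lra.
Qed.

(** A change of upper half-plane within a small ball takes place near the horizontal
    axis, hence away from the vertical one. *)
Lemma same_side d p q r : 0 < d -> far d p -> far d r ->
  upper p != upper q -> close d p q -> close d p r -> (0 < r.1) = (0 < p.1).
Proof.
move=> d0 fp fr hu cpq /andP[c1 c2].
have hp := upper_change_axis hu cpq.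
have {}fp : d <= `|p.1| by case/orP: fp => // h; lra.
have {}fr : d <= `|r.1|.
  case/orP: fr => // h.
  have := ler_normD (p.2 - r.2) (- p.2); rewrite normrN.
  have -> : p.2 - r.2 - p.2 = - r.2 by ring.
  rewrite normrN; lra.
move: c1; rewrite ltr_norml => /andP[c1 c1'].
move: fp fr; case: (ger0P p.1) => hp1; case: (ger0P r.1) => hr1 fp fr.
- by apply/idP/idP => _; lra.
- lra.
- lra.
- by apply/idP/idP => ?; lra.
Qed.

(** A small cell lies on one side of the origin: either it does not meet the
    horizontal axis, or every change of half-plane inside it counts in the same
    way, so that the two ways from p to r through q or s have equal parity. *)
Lemma cross_cell d p q r s : 0 < d -> far d p -> far d q -> far d r -> far d s ->
  close d p q -> close d p r -> close d p s ->
  cross p q (+) cross q r = cross s r (+) cross p s.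
Proof.
move=> d0 fp fq fr fs cq cr cs; rewrite /cross.
case: (boolP [&& upper q == upper p, upper r == upper p & upper s == upper p]).
  by case/and3P=> /eqP -> /eqP -> /eqP ->; rewrite addbb.
move=> hn.
have {hn} [z hz cz] : exists2 z, upper p != upper z & close d p z.
  move: hn; rewrite !negb_and => /or3P[] h; [exists q|exists r|exists s] => //;
  by rewrite eq_sym.
rewrite (same_side d0 fp fq hz cz cq) (same_side d0 fp fs hz cz cs).
by case: (0 < p.1); rewrite ?andbT ?andbF //;
   case: (upper p); case: (upper q); case: (upper r); case: (upper s).
Qed.

Lemma upper_opp p : p != 0 -> upper (- p) = ~~ upper p.
Proof.
move=> h; rewrite /upper /=.
case: (ltrgtP 0 p.2) => [h2|h2|h2] //=.
- by rewrite oppr_gt0 oppr_eq0 ltNge (ltW h2) (gt_eqF h2).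
- by rewrite oppr_gt0 h2.
- rewrite -h2 oppr0 ltxx eqxx /= oppr_gt0.
  case: (ltrgtP p.1 0) => // h1; case/eqP: h.
  by rewrite [p]surjective_pairing h1 -h2.
Qed.

Lemma far_neq0 d p : 0 < d -> far d p -> p != 0.
Proof.
move=> d0; apply: contraTneq => ->.
by rewrite /far /= normr0 orbb -ltNge.
Qed.

Lemma far_opp d p : far d (- p) = far d p.
Proof. by rewrite /far /= !normrN. Qed.

Lemma far_norm d p : d <= `|p| -> far d p.
Proof. by rewrite prod_normE le_max. Qed.

Lemma close_norm d p q : `|p - q| < d / 2 -> close d p q.
Proof. by rewrite prod_normE gt_max. Qed.

(** Reversed, a vector crosses the positive axis when the original crosses the
    negative one; together the two count all changes of half-plane. *)
Lemma cross_opp d p q : 0 < d -> far d p -> far d q -> close d p q ->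
  cross (- p) (- q) = cross p q (+) (upper p (+) upper q).
Proof.
move=> d0 fp fq c; rewrite /cross !upper_opp ?(far_neq0 d0) //.
rewrite addbN addNb negbK.
case: (boolP (upper p == upper q)) => [/eqP ->|hu]; first by rewrite addbb.
have -> : upper p (+) upper q = true by move: hu; case: upper; case: upper.
have hp := upper_change_axis hu c.
have {}fp : d <= `|p.1| by case/orP: fp => // h; lra.
rewrite /= oppr_gt0; move: fp; rewrite addbT.
case: (ltrgtP 0 p.1) => // <-; rewrite normr0; lra.
Qed.

(** If every cell of a grid is balanced then so is the whole rectangle. *)
Lemma grid_parity (B L : nat -> nat -> bool) m n :
  (forall i j, (i < m)%N -> (j < n)%N ->
     B i j (+) L i.+1 j = B i j.+1 (+) L i j) ->
  (\big[addb/false]_(i < m) B i 0%N) (+) \big[addb/false]_(j < n) L m j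
  = (\big[addb/false]_(i < m) B i n) (+) \big[addb/false]_(j < n) L 0%N j.
Proof.
elim: m => [|m IH] cell; first by rewrite !big_ord0.
have strip k : (k <= n)%N ->
    B m 0%N (+) \big[addb/false]_(j < k) L m.+1 j
    = B m k (+) \big[addb/false]_(j < k) L m j.
  elim: k => [|k IHk] hk; first by rewrite !big_ord0.
  rewrite !big_ord_recr /= addbA IHk 1?ltnW //.
  rewrite -addbA [X in _ (+) X]addbC addbA cell //.
  by rewrite -!addbA [L m k (+) _]addbC.
rewrite !big_ord_recr /= -addbA strip //.
rewrite [B m n (+) _]addbC addbA IH; last by move=> i j hi hj; exact/cell/hj/ltnW.
by rewrite -!addbA [X in _ (+) X]addbC.
Qed.

Lemma addb_telescope (f : nat -> bool) n :
  \big[addb/false]_(i < n) (f i (+) f i.+1) = f 0%N (+) f n.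
Proof.
elim: n => [|n IH]; first by rewrite big_ord0 addbb.
by rewrite big_ord_recr /= IH; case: (f 0%N); case: (f n); case: (f n.+1).
Qed.

End Winding.

Section Uniformity.
Variable R : realType.
Local Open Scope classical_set_scope.
Local Open Scope ring_scope.
Implicit Types f g : R -> R * R.

Let I01 : set R := `[0, 1].

(** Precomposing with [clamp] makes a function continuous on the unit interval
    continuous on the line, which avoids subspace topologies. *)
Definition clamp (t : R) : R := Num.max 0 (Num.min 1 t).

Lemma clampE t : t \in `[0, 1] -> clamp t = t.
Proof.
by rewrite in_itv /= => /andP[t0 t1]; rewrite /clamp (min_idPr t1) (max_idPr t0).
Qed.

Lemma clamp_in t : clamp t \in `[0, 1].
Proof.
rewrite in_itv /= /clamp le_max lexx /= ge_max ler01 /=.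
by rewrite ge_min lexx.
Qed.

Lemma clamp_lip s t : `|clamp s - clamp t| <= `|s - t|.
Proof.
have := ler_norm (s - t); have := ler_norm (t - s).
rewrite (distrC t) ler_norml /clamp => h1 h2.
by case: (leP 1 s) => ?; case: (leP 1 t) => ?; rewrite ?(max_idPr ler01) //;
  try case: (leP 0 s) => ?; try case: (leP 0 t) => ?; apply/andP; split; lra.
Qed.

Lemma clamp_continuous f : {within `[0, 1], continuous f} ->
  continuous (f \o clamp).
Proof.
move=> /subspace_continuousP cf x; apply/cvgrPdist_lt => e e0.
have := cf (clamp x) (clamp_in x) => /cvgrPdist_lt/(_ e e0) /=.
rewrite near_withinE => /nbhs_ballP[d /= d0 hd].
apply/nbhs_ballP; exists d => //= y xy; apply: hd; last exact: clamp_in.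
exact: le_lt_trans (clamp_lip x y) xy.
Qed.

Lemma compact_square : compact (I01 `*` I01).
Proof. by apply: compact_setX; exact: segment_compact. Qed.

Lemma dist_continuous f g : continuous f -> continuous g ->
  continuous (fun z : R * R => `|f z.1 - g z.2|).
Proof.
move=> cf cg z; apply: (@cvg_norm _ _ _ (nbhs z)); apply: cvgB.
  apply: (@continuous_comp _ _ _ fst f); [exact: cvg_fst|exact: cf].
apply: (@continuous_comp _ _ _ snd g); [exact: cvg_snd|exact: cg].
Qed.

(** Heine-Cantor: s and t with f s and f t at distance at least e form a compact
    set, on which the distance of s and t has a positive minimum. *)
Lemma uniformly_close f (e : R) : {within `[0, 1], continuous f} -> 0 < e ->
  exists2 d : R, 0 < d & forall s t, s \in `[0, 1] -> t \in `[0, 1] ->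
    `|s - t| < d -> `|f s - f t| < e.
Proof.
move=> /clamp_continuous; set F := f \o clamp => cF e0.
pose K := (I01 `*` I01) `&` [set z | e <= `|F z.1 - F z.2|].
have cK : compact K.
  apply: compact_closedI; first exact: compact_square.
  have := @closed_comp _ _ (fun z : R * R => `|F z.1 - F z.2|) [set y | e <= y].
  apply; last exact: closed_ge.
  by move=> z _; exact: dist_continuous.
have inK s t : s \in `[0, 1] -> t \in `[0, 1] -> e <= `|f s - f t| -> K (s, t).
  by move=> hs ht h; split=> //; rewrite /F /= !clampE.
have [K0|/set0P/negP/negPn/eqP K0] := pselect (K !=set0); last first.
  exists 1 => // s t hs ht _; rewrite ltNge; apply/negP => /(inK _ _ hs ht).
  by rewrite K0.
have [] := compact_EVT_min K0 cK (f := fun z => `|z.1 - z.2|).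
  apply: continuous_subspaceT => z; apply: (@cvg_norm _ _ _ (nbhs z)).
  by apply: cvgB; [exact: cvg_fst|exact: cvg_snd].
move=> [c1 c2] /set_mem [_ /= hc] hmin.
exists `|c1 - c2|.
  rewrite normr_gt0 subr_eq0; apply/negP => /eqP c12.
  by move: hc; rewrite c12 subrr normr0 leNgt e0.
move=> s t hs ht; rewrite ltNge => h; rewrite ltNge; apply/negP => /(inK _ _ hs ht).
by move=> /mem_set /hmin /=; apply/negP.
Qed.

Lemma uniformly_far f g :
  {within `[0, 1], continuous f} -> {within `[0, 1], continuous g} ->
  (forall s t, s \in `[0, 1] -> t \in `[0, 1] -> f s <> g t) ->
  exists2 d : R, 0 < d & forall s t, s \in `[0, 1] -> t \in `[0, 1] ->
    d <= `|f s - g t|.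
Proof.
move=> /clamp_continuous cF /clamp_continuous cG fg.
have K0 : I01 `*` I01 !=set0.
  by exists (0, 0); split; rewrite /I01 /= in_itv /= lexx ler01.
have [] := compact_EVT_min K0 compact_square
  (f := fun z => `|(f \o clamp) z.1 - (g \o clamp) z.2|).
  by apply: continuous_subspaceT; exact: dist_continuous.
move=> [c1 c2] /set_mem [/= h1 h2] hmin.
exists `|(f \o clamp) c1 - (g \o clamp) c2|.
  by rewrite normr_gt0 subr_eq0 /= !clampE //; apply/eqP; exact: fg.
move=> s t hs ht; have /mem_set/hmin := (conj hs ht : (I01 `*` I01) (s, t)).
by rewrite /= !(clampE hs) !(clampE ht).
Qed.

Lemma finite_lower_bound (I : finType) (P : pred I) (d : I -> R) :
  (forall i, P i -> 0 < d i) -> exists2 e : R, 0 < e & forall i, P i -> e <= d i.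
Proof.
move=> d0; exists (\big[Num.min/1]_(i | P i) d i).
  by apply: lt_bigmin.
by move=> i Pi; exact: bigmin_le_cond.
Qed.

End Uniformity.

Section Planar.
Variables (R : realType) (G : sgraph).
Local Open Scope classical_set_scope.
Local Open Scope ring_scope.

(** Parametrize all arcs by the same n equally spaced times, with n so large that
    each step is short compared with the distances between disjoint edges; the
    parities are then numbers of crossing steps. *)
Theorem planar_z2planar : planar R G -> z2planar (@adj G).
Proof.
move=> [pt [arc [pt_inj harc hvert hcross]]].
have ends t : t \in `[0, 1] -> [\/ t = 0, t = 1 | t \in (`]0, 1[ : interval R)].
  rewrite !in_itv /= => /andP[]; rewrite !le_eqVlt.
  move=> /predU1P[<-|h0]; first by constructor 1.
  by move=> /predU1P[->|h1]; [constructor 2|constructor 3; rewrite h0].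
have off_vertex u v w t : adj u v -> w != u -> w != v -> t \in `[0, 1] ->
    arc u v t <> pt w.
  move=> uv wu wv /ends[->|->|ht]; last exact: hvert.
    by case: (harc _ _ uv) => _ _ -> _ _ /pt_inj/esym/eqP; apply/negP.
  by case: (harc _ _ uv) => _ _ _ -> _ /pt_inj/esym/eqP; apply/negP.
pose disj (q : (G * G) * (G * G)) := let: ((u, v), (x, y)) := q in
  [/\ adj u v, adj x y & [/\ x != u, x != v, y != u & y != v]].
have off_edge u v x y s t : disj ((u, v), (x, y)) ->
    s \in `[0, 1] -> t \in `[0, 1] -> arc u v s <> arc x y t.
  move=> [uv xy [xu xv yu yv]] hs.
  case: (harc _ _ uv) => _ _ a0 a1 _; case: (harc _ _ xy) => _ _ b0 b1 _.
  move=> /ends[->|->|ht]; rewrite ?b0 ?b1; try exact: off_vertex.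
  case: (ends s hs) => [->|->|{}hs]; rewrite ?a0 ?a1.
  - by apply/nesym; apply: hvert.
  - by apply/nesym; apply: hvert.
  apply: hcross => // /setP/(_ x); rewrite !inE eqxx /=.
  by rewrite (negbTE xu) (negbTE xv).
have /choice[D hD] : forall q, exists d : R, disj q ->
    0 < d /\ forall s t, s \in `[0, 1] -> t \in `[0, 1] ->
      d <= `|arc q.1.1 q.1.2 s - arc q.2.1 q.2.2 t|.
  move=> [[u v] [x y]].
  have [dq|ndq] := pselect (disj ((u, v), (x, y))); last by exists 0 => /ndq.
  have [uv xy _] := dq.
  case: (harc _ _ uv) => cf _ _ _ _; case: (harc _ _ xy) => cg _ _ _ _.
  have [d d0 hd] := uniformly_far cf cg (fun s t => off_edge _ _ _ _ s t dq).
  by exists d.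
have [e e0 he] := @finite_lower_bound R _ (fun q => `[< disj q >]) D
  (fun q hq => (hD q (asboolW hq)).1).
(* with steps shorter than e / 4 the diagonal of a cell is shorter than e / 2 *)
have /choice[U hU] : forall q : G * G, exists d : R, adj q.1 q.2 -> 0 < d /\
    forall s t, s \in `[0, 1] -> t \in `[0, 1] -> `|s - t| < d ->
     `|arc q.1 q.2 s - arc q.1 q.2 t| < e / 4.
  move=> [u v] /=.
  have [uv|] := boolP (adj u v); last by exists 0.
  case: (harc _ _ uv) => cf _ _ _ _.
  have e4 : 0 < e / 4 by lra.
  by have [d d0 hd] := uniformly_close cf e4; exists d.
have [m m0 hm] := @finite_lower_bound R _ (fun q : G * G => adj q.1 q.2) U
  (fun q hq => (hU q hq).1).
pose n := Num.bound m^-1.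
have n0 : 0 < n%:R :> R.
  by apply: lt_trans (archi_boundP _); rewrite ?invr_ge0 ?invr_gt0 // ltW.
have nm : n%:R^-1 < m.
  by rewrite invf_plt ?posrE //; apply: archi_boundP; rewrite invr_ge0 ltW.
pose tau i : R := i%:R / n%:R.
have tau0 : tau 0%N = 0 by rewrite /tau mul0r.
have tau1 : tau n = 1 by rewrite /tau divff // gt_eqF.
have tauI i : (i <= n)%N -> tau i \in `[0, 1].
  by move=> h; rewrite in_itv /= /tau divr_ge0 //= ler_pdivrMr // mul1r ler_nat.
have tauS i : `|tau i - tau i.+1| < m.
  rewrite /tau -mulrBl -natr1 opprD addNKr mulN1r normrN.
  by rewrite ger0_norm // invr_ge0 ltW.
pose k w u v := \big[addb/false]_(i < n)
  cross (arc u v (tau i) - pt w) (arc u v (tau i.+1) - pt w).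
pose h u w := upper (pt u - pt w).
exists k, h; split.
  move=> u w uw; rewrite /h -opprB upper_opp // subr_eq0.
  by apply: contra uw => /eqP/pt_inj ->.
move=> u v x y uv xy xu xv yu yv.
have dq : disj ((u, v), (x, y)) by [].
pose P i j := arc u v (tau i) - arc x y (tau j).
have farP i j : (i <= n)%N -> (j <= n)%N -> far e (P i j).
  move=> hi hj; apply: far_norm; apply: (le_trans (he _ (asboolT dq))).
  by apply: (hD _ dq).2; exact: tauI.
have stepu i j : (i < n)%N -> `|P i j - P i.+1 j| < e / 4.
  move=> hi; rewrite /P opprB addrA subrK.
  apply: (hU (u, v) uv).2; rewrite ?tauI // 1?ltnW //.
  exact: lt_le_trans (tauS i) (hm (u, v) uv).
have stepx i j : (j < n)%N -> `|P i j - P i j.+1| < e / 4.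
  move=> hj; rewrite /P opprB addrC addrA subrK distrC.
  apply: (hU (x, y) xy).2; rewrite ?tauI // 1?ltnW //.
  exact: lt_le_trans (tauS j) (hm (x, y) xy).
have e42 : e / 4 <= e / 2 by lra.
have cell : forall i j, (i < n)%N -> (j < n)%N ->
    cross (P i j) (P i.+1 j) (+) cross (P i.+1 j) (P i.+1 j.+1)
    = cross (P i j.+1) (P i.+1 j.+1) (+) cross (P i j) (P i j.+1).
  move=> i j hi hj; have hi' := ltnW hi; have hj' := ltnW hj.
  apply: (@cross_cell _ e) => //; try exact: farP.
  - by apply: close_norm; apply: lt_le_trans e42; exact: stepu.
  - apply: close_norm; rewrite -(subrKA (P i.+1 j)).
    apply: (le_lt_trans (ler_normD _ _)).
    have := stepu i j hi; have := stepx i.+1 j hj; lra.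
  - by apply: close_norm; apply: lt_le_trans e42; exact: stepx.
have := grid_parity cell.
case: (harc _ _ uv) => _ _ a0 a1 _; case: (harc _ _ xy) => _ _ b0 b1 _.
have -> : \big[addb/false]_(i < n) cross (P i 0%N) (P i.+1 0%N) = k x u v.
  by apply: eq_bigr => i _; rewrite /P tau0 b0.
have -> : \big[addb/false]_(i < n) cross (P i n) (P i.+1 n) = k y u v.
  by apply: eq_bigr => i _; rewrite /P tau1 b1.
(* on the two sides of the grid where the first point stands at an end w of uv,
   P is opposite to the direction from w to the second point *)
have flip w i : (w = u /\ i = 0%N) \/ (w = v /\ i = n) ->
    \big[addb/false]_(j < n) cross (P i j) (P i j.+1)
    = k w x y (+) (h x w (+) h y w).
  move=> hw.
  have Pw j : P i j = - (arc x y (tau j) - pt w).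
    by rewrite opprB /P; case: hw => [[-> ->]|[-> ->]]; rewrite ?tau0 ?tau1 ?a0 ?a1.
  have hi : (i <= n)%N by case: hw => [[_ ->]|[_ ->]].
  pose f j := upper (arc x y (tau j) - pt w).
  have -> : h x w (+) h y w = \big[addb/false]_(j < n) (f j (+) f j.+1).
    by rewrite addb_telescope /f tau0 tau1 b0 b1.
  rewrite /k -big_split; apply: eq_bigr => -[j hj] _ /=.
  have hj' := ltnW hj.
  have farw l : (l <= n)%N -> far e (arc x y (tau l) - pt w).
    by move=> hl; have := farP i l hi hl; rewrite Pw far_opp.
  rewrite !Pw (@cross_opp _ e) ?farw //; apply: close_norm.
  by apply: lt_le_trans e42; rewrite -normrN opprD; have := stepx i j hj; rewrite !Pw.
rewrite (flip v n) ?(flip u 0%N); [|by left|by right].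
rewrite /h; move: (k x u v) (k y u v) (k u x y) (k v x y).
move: (upper _) (upper _) (upper _) (upper _).
by do 8!case.
Qed.

End Planar.

(** * Drawings with the vertices on a line *)

(** The two sides of the line are the two pages of a book; [page] tells on which one
    an edge is drawn. *)
Definition book_embedding (G : sgraph) (f : G -> nat) (page : rel G) : Prop :=
  [/\ injective f, symmetric page &
   forall u v x y, adj u v -> adj x y -> page u v = page x y ->
     ~~ [&& f u < f x, f x < f v & f v < f y]].

Section Book.
Variable R : realType.
Local Open Scope classical_set_scope.
Local Open Scope ring_scope.

(** Over the abscissa x, the arc between the abscissas p and q has height
    (x - p) (q - x) in absolute value. *)
Definition parabola (b : bool) (p q t : R) : R * R :=
  ((1 - t) * p + t * q, (if b then 1 else -1) * (t * (1 - t) * (q - p) ^+ 2)).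

Lemma parabola_rev b p q t : parabola b q p t = parabola b p q (1 - t).
Proof. by congr pair; ring. Qed.

(** Of two nested arcs on one side of the line, the outer one is strictly higher. *)
Lemma parabola_meet b (p q p' q' s t : R) :
  p < q -> p' < q' -> s \in `]0, 1[ -> t \in `]0, 1[ ->
  ~~ [&& p < p', p' < q & q < q'] -> ~~ [&& p' < p, p < q' & q' < q] ->
  parabola b p q s = parabola b p' q' t -> p = p' /\ q = q'.
Proof.
rewrite !in_itv /= => pq pq' /andP[s0 s1] /andP[t0 t1] n1 n2 [].
set X := (1 - s) * p + s * q => hX.
have -> : s * (1 - s) * (q - p) ^+ 2 = (X - p) * (q - X) by rewrite /X; ring.
have -> : t * (1 - t) * (q' - p') ^+ 2 = (X - p') * (q' - X).
  by rewrite hX; ring.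
have hp : p < X by rewrite /X; nra.
have hq : X < q by rewrite /X; nra.
have hp' : p' < X by rewrite hX; nra.
have hq' : X < q' by rewrite hX; nra.
move=> hY.
have {}hY : (X - p) * (q - X) = (X - p') * (q' - X).
  by move: hY; case: (b); rewrite ?mul1r ?mulN1r // => /oppr_inj.
move: n1 n2; rewrite (lt_trans hp' hq) (lt_trans hp hq') /= => n1 n2.
case: (ltrgtP p p') n1 n2 => [h|h|h] /= n1 n2.
- by move: n1; rewrite -leNgt => n1; exfalso; nra.
- by move: n2; rewrite -leNgt => n2; exfalso; nra.
- split=> //; subst p'.
  have : (X - p) * (q - q') = 0 by lra.
  by move/eqP; rewrite mulf_eq0 !subr_eq0 (gt_eqF hp) => /eqP.
Qed.

Lemma parabola_continuous b p q : continuous (parabola b p q).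
Proof.
have ct : continuous (fun t : R => t) by move=> ?; exact: cvg_id.
have cc (c : R) : continuous (fun _ : R => c) by move=> ?; exact: cvg_cst.
have c1 : continuous (fun t : R => 1 - t).
  by move=> t; apply: cvgB; [exact: cc|exact: ct].
move=> t.
have cx : (1 - x) * p + x * q @[x --> t] --> (1 - t) * p + t * q.
  by apply: cvgD; apply: cvgM; (exact: c1 || exact: cc || exact: ct).
have cy : (if b then 1 else -1) * (x * (1 - x) * (q - p) ^+ 2) @[x --> t]
    --> (if b then 1 else -1) * (t * (1 - t) * (q - p) ^+ 2).
  apply: cvgM; first exact: cc.
  by apply: cvgM; [apply: cvgM; [exact: ct|exact: c1]|exact: cc].
exact: cvg_pair cx cy.
Qed.

Theorem book_planar (G : sgraph) (f : G -> nat) page :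
  book_embedding f page -> planar R G.
Proof.
move=> [f_inj page_sym nocross].
exists (fun v => ((f v)%:R, 0)).
exists (fun u v => parabola (page u v) (f u)%:R (f v)%:R).
have fne u v : adj u v -> f u != f v.
  by apply: contraTneq => /f_inj ->; rewrite adj_irr.
split.
- by move=> u v [/eqP]; rewrite eqr_nat => /eqP /f_inj.
- move=> u v uv; split.
  + by apply: continuous_subspaceT; exact: parabola_continuous.
  + move=> s t _ _ [/eqP + _].
    rewrite -subr_eq0.
    have -> : (1 - s) * (f u)%:R + s * (f v)%:R - ((1 - t) * (f u)%:R + t * (f v)%:R)
      = (s - t) * ((f v)%:R - (f u)%:R) by ring.
    rewrite mulf_eq0 !subr_eq0 eqr_nat eq_sym => /orP[/eqP //|].
    by rewrite eq_sym (negbTE (fne _ _ uv)).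
  + by congr pair; ring.
  + by congr pair; ring.
  + by move=> t _; rewrite page_sym parabola_rev.
- move=> u v w t uv; rewrite in_itv /= => /andP[t0 t1] [_] /eqP.
  rewrite mulf_eq0 => /orP[]; first by case: (page u v); rewrite ?oppr_eq0 oner_eq0.
  rewrite !mulf_eq0 (gt_eqF t0) subr_eq0 (gt_eqF t1) orbb subr_eq0 eqr_nat.
  by rewrite eq_sym (negbTE (fne _ _ uv)).
- move=> u v x y s t uv xy ne hs ht.
  wlog uv_lt : u v s uv ne hs / (f u < f v)%N.
    move=> H; have [|h|h] := ltngtP (f u) (f v); first exact: H.
      rewrite page_sym parabola_rev; apply: H => //.
      * by rewrite adj_sym.
      * by rewrite finset.setUC.
      * by move: hs; rewrite !in_itv /= => /andP[? ?]; apply/andP; split; lra.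
    by move: (fne _ _ uv); rewrite h eqxx.
  wlog xy_lt : x y t xy ne ht / (f x < f y)%N.
    move=> H; have [|h|h] := ltngtP (f x) (f y); first exact: H.
      rewrite [page x y]page_sym [parabola _ (f x)%:R _ _]parabola_rev; apply: H => //.
      * by rewrite adj_sym.
      * by rewrite [[set y; x]%SET]finset.setUC.
      * by move: ht; rewrite !in_itv /= => /andP[? ?]; apply/andP; split; lra.
    by move: (fne _ _ xy); rewrite h eqxx.
  have [pe|pn] := eqVneq (page u v) (page x y); last first.
    move=> [_ /eqP]; move: hs ht; rewrite !in_itv /= => /andP[s0 s1] /andP[t0 t1].
    have pos (a b r : R) : 0 < r -> r < 1 -> a < b -> 0 < r * (1 - r) * (b - a) ^+ 2.
      by move=> r0 r1 ab; rewrite !mulr_gt0 ?subr_gt0 // exprn_gt0 // subr_gt0.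
    have := pos (f u)%:R (f v)%:R s s0 s1; rewrite ltr_nat => /(_ uv_lt).
    have := pos (f x)%:R (f y)%:R t t0 t1; rewrite ltr_nat => /(_ xy_lt).
    by move: pn; case: (page u v); case: (page x y) => //= _; lra.
  rewrite pe => /parabola_meet; rewrite !ltr_nat => /(_ uv_lt xy_lt hs ht).
  case.
  + exact: nocross.
  + by apply: nocross.
  move=> /eqP; rewrite eqr_nat => /eqP/f_inj eu /eqP; rewrite eqr_nat => /eqP/f_inj ev.
  by case: ne; rewrite eu ev.
Qed.

End Book.

(** * Minors *)

Section DeleteEdge.
Variables (G : sgraph) (u v : G).

Definition del_edge_adj : rel G := fun x y =>
  adj x y && ~~ ((x == u) && (y == v) || (x == v) && (y == u)).

Fact del_edge_sym : symmetric del_edge_adj.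
Proof.
move=> x y; rewrite /del_edge_adj adj_sym; congr (_ && ~~ _).
by rewrite orbC; congr (_ || _); rewrite andbC.
Qed.

Fact del_edge_irr : irreflexive del_edge_adj.
Proof. by move=> x; rewrite /del_edge_adj adj_irr. Qed.

Definition del_edge : sgraph := SGraph del_edge_sym del_edge_irr.

End DeleteEdge.

Lemma iso_sym G H : iso G H -> iso H G.
Proof.
move=> [f [[g fK gK] fa]]; exists g; split; first by exists f.
by move=> x y; rewrite -fa !gK.
Qed.

Lemma iso_trans G H K : iso G H -> iso H K -> iso G K.
Proof.
move=> [f [bf fa]] [g [bg ga]]; exists (g \o f); split; first exact: bij_comp.
by move=> x y /=; rewrite ga fa.
Qed.

Lemma iso_subgraph G H : iso G H -> subgraph G H.
Proof.
by move=> [f [bf fa]]; exists f; split=> [|x y]; [exact: bij_inj|rewrite fa].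
Qed.

Lemma subgraph_trans G H K : subgraph G H -> subgraph H K -> subgraph G K.
Proof.
move=> [f [fi fa]] [g [gi ga]]; exists (g \o f); split; first exact: inj_comp.
by move=> x y /fa/ga.
Qed.

Lemma minor_subgraph G H K : is_minor K G -> subgraph G H -> is_minor K H.
Proof. by move=> [S [SG r]] GH; exists S; split=> //; exact: subgraph_trans GH. Qed.

Section ContractMap.
Variables (S G : sgraph) (f : S -> G) (u v : S).
Hypothesis fi : injective f.

Fact contract_map_proof (x : contract u v) : f (val x) != f v.
Proof. by rewrite (inj_eq fi); exact: valP x. Qed.

Definition contract_map (x : contract u v) : contract (f u) (f v) :=
  exist _ (f (val x)) (contract_map_proof x).

Lemma contract_map_inj : injective contract_map.
Proof. by move=> x y /(congr1 val) /fi /val_inj. Qed.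

Lemma contract_map_adj : (forall x y, adj x y -> adj (f x) (f y)) ->
  forall x y, adj x y -> adj (contract_map x) (contract_map y).
Proof.
move=> fa x y /andP[ne h]; apply/andP; split.
  by rewrite (inj_eq contract_map_inj).
rewrite /= !(inj_eq fi).
by case/or3P: h => [/fa ->|/andP[-> /fa ->]|/andP[-> /fa ->]]; rewrite ?orbT.
Qed.

End ContractMap.

Lemma contract_subgraph S G (f : S -> G) (u v : S) : injective f ->
  (forall x y, adj x y -> adj (f x) (f y)) ->
  subgraph (contract u v) (contract (f u) (f v)).
Proof.
move=> fi fa; exists (contract_map (v := v) fi); split.
  exact: contract_map_inj.
exact: contract_map_adj.
Qed.

Lemma contract_iso S H (f : S -> H) (u v : S) : bijective f ->
  (forall x y, adj (f x) (f y) = adj x y) ->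
  iso (contract u v) (contract (f u) (f v)).
Proof.
move=> bf fa; have fi := bij_inj bf; have [g fK gK] := bf.
have gP (y : contract (f u) (f v)) : g (val y) != v.
  by rewrite -(inj_eq fi) gK; exact: valP y.
exists (contract_map (v := v) fi); split.
  exists (fun y => exist _ (g (val y)) (gP y) : contract u v) => x;
    apply: val_inj => /=.
    by rewrite fK.
  by rewrite gK.
move=> x y; rewrite /= /contract_adj (inj_eq (@contract_map_inj _ _ _ _ _ fi)) /=.
by rewrite !(inj_eq fi) !fa.
Qed.

(** The graph that results from contracting uv remembers that the merged vertex is
    called u. *)
Lemma contract_flip G (u v : G) : u != v -> subgraph (contract u v) (contract v u).
Proof.
move=> uv.
have hP (x : contract u v) : (if val x == u then v else val x) != u.
  by case: ifPn => // _; rewrite eq_sym.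
pose F x : contract v u := exist (fun y => y != u) _ (hP x).
have vne (x : contract u v) : val x != v := valP x.
have inj : injective F.
  move=> x y /(congr1 val) /=.
  case: eqP => xu; case: eqP => yu h; apply: val_inj => //=.
  - by rewrite xu yu.
  - by case/eqP: (vne y).
  - by case/eqP: (vne x).
exists F; split=> // x y /andP[xy h]; apply/andP; split; first by rewrite (inj_eq inj).
move: h => /=; case: (eqVneq (val x) u) => [xu|xu]; case: (eqVneq (val y) u) => [yu|yu].
- by move: xy; rewrite -(inj_eq val_inj) xu yu eqxx.
- by rewrite xu eqxx /= orbF => /orP[] ->; rewrite ?orbT.
- rewrite yu eqxx /= => /orP[h|h]; first by rewrite [adj u (sval x)]adj_sym h !orbT.
  by rewrite adj_sym h.
- by rewrite !orbF => ->.
Qed.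

(** [reach] adds steps at the end, whereas minors of G are compared with G
    through the first step. *)
Lemma reach_contract S H : reach contract_step S H -> iso S H \/
  exists u v : S, adj u v /\ reach contract_step (contract u v) H.
Proof.
elim=> [K|K L M _ IH st LM]; first by left.
right; case: IH => [/iso_sym[f [bf fa]]|[u [v [uv r]]]]; last first.
  by exists u, v; split=> //; exact: reach_step st LM.
case: st LM => u v uv LM; exists (f u), (f v); split; first by rewrite fa.
by apply: reach_iso; apply: iso_trans LM; exact/iso_sym/contract_iso.
Qed.

(** A missing vertex is treated as a missing edge, which exists because there
    are no isolated vertices. *)
Lemma minor_step G H : (forall x : G, exists y, adj x y) -> is_minor H G ->
  [\/ iso G H,
      exists u v : G, adj u v /\ is_minor H (del_edge u v) |
      exists u v : G, adj u v /\ is_minor H (contract u v)].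
Proof.
move=> noiso [S [[f [fi fa]] /reach_contract[SH|[u [v [uv r]]]]]]; last first.
  constructor 3; exists (f u), (f v); split; first exact: fa.
  by exists (contract u v); split=> //; exact: contract_subgraph.
have sub (u v : G) : (forall x y : S, adj x y ->
    ~~ ((f x == u) && (f y == v) || (f x == v) && (f y == u))) ->
  is_minor H (del_edge u v).
  move=> h; exists S; split; last exact: reach_iso.
  by exists f; split=> // x y xy; apply/andP; split; [exact: fa|exact: h].
have [/forallP fsurj|/forallPn[x hx]] := boolP [forall x, x \in codom f].
  have [/forallP fadj|/forallPn[x /forallPn[y]]] :=
    boolP [forall x, forall y, adj (f x) (f y) ==> adj x y].
    constructor 1; apply: iso_trans SH; apply: iso_sym; exists f; split.
      by apply: (inj_card_bij fi); rewrite -(card_codom fi) subset_leq_card //;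
         apply/fintype.subsetP => x _; exact: fsurj.
    move=> x y; apply/idP/idP; last exact: fa.
    by move: (fadj x) => /forallP/(_ y)/implyP.
  rewrite negb_imply => /andP[h n]; constructor 2; exists (f x), (f y); split=> //.
  apply: sub => x' y' xy; rewrite !(inj_eq fi); apply/negP.
  case/orP => /andP[/eqP e1 /eqP e2]; subst x' y'; move: n; first by rewrite xy.
  by rewrite adj_sym xy.
have [y xy] := noiso x; constructor 2; exists x, y; split=> //.
apply: sub => x' y' _; apply/negP.
by case/orP => /andP[/eqP e1 /eqP e2]; case/negP: hx; rewrite -?e1 -?e2 codom_f.
Qed.

Section Apex.
Variables (R : realType) (n : nat).

Lemma planar_subgraph G H : subgraph H G -> planar R G -> planar R H.
Proof.
move=> [f [fi fa]] [pt [arc [pi h1 h2 h3]]].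
exists (pt \o f), (fun u v => arc (f u) (f v)); split.
- exact: inj_comp.
- by move=> u v /fa/h1.
- by move=> u v w t /fa; exact: h2.
- move=> u v x y s t /fa uv /fa xy ne; apply: h3 => // e; apply: ne.
  apply/setP => z; move/setP/(_ (f z)): e; rewrite !inE.
  by rewrite !(inj_eq fi).
Qed.

Lemma card_preimset_inj (T U : finType) (f : T -> U) (A : {set U}) :
  injective f -> #|[set x | f x \in A]| <= #|A|.
Proof.
move=> fi; rewrite -(card_imset _ fi); apply: subset_leq_card.
by apply/fintype.subsetP => _ /imsetP[x + ->]; rewrite inE.
Qed.

Lemma del_subgraph G H (f : H -> G) (X : {set G}) (Y : {set H}) :
  injective f -> (forall x y, adj x y -> adj (f x) (f y)) ->
  (forall x, x \notin Y -> f x \notin X) -> subgraph (del Y) (del X).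
Proof.
move=> fi fa fX.
exists (fun x : del Y => exist _ (f (val x)) (fX _ (valP x)) : del X); split.
  by move=> x y /(congr1 val) /= /fi /val_inj.
by move=> x y; exact: fa.
Qed.

Lemma n_apex_subgraph G H : subgraph H G -> n_apex R n G -> n_apex R n H.
Proof.
move=> [f [fi fa]] [X [cX pX]]; exists [set x | f x \in X]; split.
  exact: leq_trans (card_preimset_inj _ fi) cX.
by apply: planar_subgraph pX; apply: del_subgraph fi fa _ => x; rewrite inE.
Qed.

Definition minors_apex G := forall H, is_minor H G -> n_apex R n H.

Lemma minors_apex_subgraph G H : subgraph H G -> minors_apex G -> minors_apex H.
Proof. by move=> HG mG K KH; apply: mG; exact: minor_subgraph HG. Qed.

Lemma proper_minors_apex G : (forall x : G, exists y, adj x y) ->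
  (forall u v : G, adj u v -> minors_apex (del_edge u v)) ->
  (forall u v : G, adj u v -> minors_apex (contract u v)) ->
  forall H, proper_minor H G -> n_apex R n H.
Proof.
move=> noiso hd hc H [/(minor_step noiso)[GH|[u [v [uv m]]]|[u [v [uv m]]]] ne].
- by case: ne; exact: iso_sym.
- exact: hd m.
- exact: hc m.
Qed.

End Apex.

(** * Near-outerplanar graphs *)

Definition between (i j k : nat) := minn j k < i < maxn j k.

Lemma betweenC i j k : between i j k = between i k j.
Proof. by rewrite /between minnC maxnC. Qed.

Lemma betweennn i j : between i j j = false.
Proof. by rewrite /between minnn maxnn; case: ltngtP. Qed.

(** Two chords cross or not, independently of which of them is taken to separate
    the ends of the other. *)
Lemma between_swap a b c d : a != c -> a != d -> b != c -> b != d ->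
  between c a b = between d a b -> between a c d = between b c d.
Proof.
wlog ab : a b / a < b.
  move=> H ac ad bc bd; case: (ltngtP a b) => [h|h|-> //]; first exact: H.
  by rewrite betweenC [between d _ _]betweenC => e; apply/esym/(H b a).
wlog cd : c d / c < d.
  move=> H ac ad bc bd; case: (ltngtP c d) => [h|h|-> ]; first exact: H.
    by move=> e; rewrite betweenC [RHS]betweenC; apply: (H d c).
  by rewrite !betweennn.
rewrite /between (minn_idPl (ltnW ab)) (maxn_idPr (ltnW ab)).
rewrite (minn_idPl (ltnW cd)) (maxn_idPr (ltnW cd)).
by case: (ltngtP a c) => // ? _; case: (ltngtP a d) => // ? _;
   case: (ltngtP b c) => // ? _; case: (ltngtP b d) => // ? _ /=; lia.
Qed.

Lemma between_sorted (T : Type) (e : rel T) (f : T -> nat) : symmetric e ->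
  (forall u v x y, e u v -> e x y -> ~~ [&& f u < f x, f x < f v & f v < f y]) ->
  forall u v x y, e u v -> e x y ->
    f u != f x -> f u != f y -> f v != f x -> f v != f y ->
  between (f u) (f x) (f y) = between (f v) (f x) (f y).
Proof.
move=> es H u v x y; wlog uv : u v / f u < f v.
  move=> G; case: (ltngtP (f u) (f v)) => [h|h|-> //]; first exact: G.
  by rewrite es => *; apply/esym/G.
wlog xy : x y / f x < f y.
  move=> G; case: (ltngtP (f x) (f y)) => [h|h|h]; first exact: G.
    by rewrite [e x y]es betweenC [RHS]betweenC => *; exact: G.
  by rewrite h !betweennn.
move=> euv exy ux uy vx vy.
rewrite /between (minn_idPl (ltnW xy)) (maxn_idPr (ltnW xy)).
have := H _ _ _ _ euv exy; have := H _ _ _ _ exy euv.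
by clear H euv exy es; move: ux uy vx vy uv xy; lia.
Qed.

(** The graph is outerplanar after deletion of Y.  Non-crossing of uv and xy is
    expressed by u and v lying on the same side of the chord xy; unlike
    conditions on the order of four points, this composes along paths. *)
Definition near_outerplanar m (G : sgraph) : Prop :=
  exists (Y : {set G}) (f : G -> nat),
  [/\ #|Y| <= m, {in ~: Y &, injective f} &
   forall u v x y, [/\ u \notin Y, v \notin Y, x \notin Y & y \notin Y] ->
     adj u v -> adj x y -> u != x -> u != y -> v != x -> v != y ->
     between (f u) (f x) (f y) = between (f v) (f x) (f y)].

Lemma near_outerplanar_subgraph m G H :
  subgraph H G -> near_outerplanar m G -> near_outerplanar m H.
Proof.
move=> [f [fi fa]] [Y [p [cY pi side]]].
exists [set x | f x \in Y], (p \o f); split.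
- exact: leq_trans (card_preimset_inj _ fi) cY.
- by move=> x y; rewrite !inE => hx hy h; apply/fi/pi; rewrite ?inE.
- move=> u v x y; rewrite !inE => h /fa uv /fa xy.
  by rewrite -!(inj_eq fi); exact: side.
Qed.

(** If u or v is in Y, then put the merged vertex into Y.  Otherwise keep the
    position of u: an edge uy stemming from vy is replaced by the path u, v, y,
    which stays on one side of every chord that misses it. *)
Lemma near_outerplanar_contract m G (u v : G) : adj u v ->
  near_outerplanar m G -> near_outerplanar m (contract u v).
Proof.
move=> uv [Y [p [cY pi side]]].
have vne (x : contract u v) : val x != v := valP x.
have [uvY|] := boolP ((u \in Y) || (v \in Y)).
  exists [set x : contract u v | (val x \in Y) || (val x == u)], (p \o val); split.
  - rewrite -(card_imset _ val_inj); apply: leq_trans cY.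
    have [vY|vY] := boolP (v \in Y).
      apply: (@leq_trans #|u |: (Y :\ v)|).
        apply/subset_leq_card/fintype.subsetP => _ /imsetP[x + ->]; rewrite !inE.
        by case/orP => ->; rewrite ?vne ?orbT.
      by rewrite cardsU1 [X in _ <= X](cardsD1 v) vY leq_add2r leq_b1.
    apply/subset_leq_card/fintype.subsetP => _ /imsetP[x + ->]; rewrite !inE.
    by case/orP => // /eqP ->; move: uvY; rewrite (negbTE vY) orbF.
  - move=> x y; rewrite !inE !negb_or => /andP[hx _] /andP[hy _] h.
    by apply/val_inj/pi; rewrite ?inE.
  - move=> a b c d; rewrite !inE !negb_or => -[/andP[aY au] /andP[bY bu]
      /andP[cY' cu] /andP[dY du]] /andP[_] /=.
    rewrite (negbTE au) (negbTE bu) !orbF => ab /andP[_] /=.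
    by rewrite (negbTE cu) (negbTE du) !orbF -!(inj_eq val_inj); exact: side.
rewrite negb_or => /andP[uY vY].
have pne x y : x \notin Y -> y \notin Y -> x != y -> p x != p y.
  by move=> hx hy; apply: contraNneq => /pi -> //; rewrite inE.
exists [set x : contract u v | val x \in Y], (p \o val); split.
- exact: leq_trans (card_preimset_inj _ val_inj) cY.
- by move=> x y; rewrite !inE => hx hy h; apply/val_inj/pi; rewrite ?inE.
(* xy is an edge of G itself, so that only ab needs a path through v *)
have once (a b : contract u v) x y : adj a b -> adj x y ->
    [/\ val a \notin Y, val b \notin Y, x \notin Y & y \notin Y] ->
    [/\ val a != x, val a != y, val b != x & val b != y] -> x != v -> y != v ->
    between (p (val a)) (p x) (p y) = between (p (val b)) (p x) (p y).
  move=> /andP[_ ab] xy [aY bY xY yY] [ax ay bx byy] xv yv.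
  have vx : v != x by rewrite eq_sym.
  have vy : v != y by rewrite eq_sym.
  case/or3P: ab => [ab|/andP[/eqP au vb]|/andP[/eqP bu va]].
  - exact: side.
  - rewrite au in ax ay *.
    by rewrite (side u v) // (side v (val b)).
  - rewrite bu in bx byy *.
    by rewrite (side (val a) v) // 1?adj_sym // (side v u) // adj_sym.
move=> a b c d; rewrite !inE => -[aY bY cY' dY] ab cd /=.
rewrite -!(inj_eq val_inj) => ac ad bc bd.
have [gcd|] := boolP (adj (val c) (val d)).
  by apply: once => //; exact: vne.
move=> ncd; have [gab|nab] := boolP (adj (val a) (val b)).
  apply: between_swap; try exact: pne.
  by apply: once => //; [split; rewrite // eq_sym|exact: vne|exact: vne].
have uin (x y : contract u v) : adj x y -> ~~ adj (val x) (val y) ->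
    val x = u \/ val y = u.
  by move=> /andP[_ /or3P[->//|/andP[/eqP -> _]|/andP[/eqP -> _]]]; [left|right].
by case: (uin _ _ ab nab) (uin _ _ cd ncd) => e [] e';
  move: ac ad bc bd; rewrite e e' eqxx.
Qed.

Lemma near_outerplanar_minor m G H :
  is_minor H G -> near_outerplanar m G -> near_outerplanar m H.
Proof.
move=> [S [SG r]] /(near_outerplanar_subgraph SG) {SG}.
have iso_near K L : iso K L -> near_outerplanar m K -> near_outerplanar m L.
  by move=> /iso_sym/iso_subgraph; exact: near_outerplanar_subgraph.
elim: r => [K SK|K L M _ IH st LM] hS; first exact: iso_near hS.
apply: (iso_near _ _ LM); case: st => u v uv.
exact: near_outerplanar_contract (IH hS).
Qed.

(** One vertex y of Y returns as the first vertex on the line; its edges use the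
    second page, where they cannot cross since they share an end. *)
Lemma near_outerplanar_apex (R : realType) n G :
  near_outerplanar n.+1 G -> n_apex R n G.
Proof.
move=> [Y [p [cY pi side]]].
have nocross u v x y : [/\ u \notin Y, v \notin Y, x \notin Y & y \notin Y] ->
    adj u v -> adj x y -> ~~ [&& p u < p x, p x < p v & p v < p y].
  move=> hY uv xy; apply/negP => /and3P[ux xv vy].
  have uy := ltn_trans ux (ltn_trans xv vy).
  have ne a b : p a < p b -> a != b by apply: contraTneq => ->; rewrite ltnn.
  have := side u v x y hY uv xy (ne _ _ ux) (ne _ _ uy).
  rewrite ![v == _]eq_sym ne // [y == v]eq_sym ne // => /(_ isT isT).
  by rewrite /between; move: ux xv vy; clear; lia.
have [Y0|[y yY]] := set_0Vmem Y.
  exists finset.set0; rewrite cards0; split=> //.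
  have nY (x : G) : x \notin Y by rewrite Y0 inE.
  apply: (@book_planar _ _ (fun x : del finset.set0 => p (val x)) (fun _ _ => true)).
  split=> //.
    by move=> u v h; apply/val_inj/pi; rewrite // inE nY.
  by move=> u v x z uv xz _; apply: nocross.
exists (Y :\ y); split; first by move: cY; rewrite (cardsD1 y) yY.
pose q (x : del (Y :\ y)) := if val x == y then 0 else (p (val x)).+1.
have qE (x : del (Y :\ y)) : 0 < q x -> q x = (p (val x)).+1 /\ val x \notin Y.
  rewrite /q; case: eqP => // /eqP ne _; split=> //.
  by have := valP x; rewrite !inE ne.
apply: (@book_planar _ _ q (fun u v : del (Y :\ y) => (val u == y) || (val v == y))).
split.
- move=> u v; case: (posnP (q u)) => [|hu].
    rewrite {1}/q; case: eqP => // uy _.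
    by rewrite /q uy eqxx; case: eqP => // vy _; apply: val_inj; rewrite vy.
  case: (posnP (q v)) => [-> h|hv]; first by rewrite h in hu.
  have [-> uY] := qE u hu; have [-> vY] := qE v hv.
  by move=> [] h; apply/val_inj/pi; rewrite ?inE.
- by move=> u v; rewrite orbC.
move=> u v x z uv xz pg; apply/negP => /and3P[l1 l2 l3].
have pos (w : del (Y :\ y)) : 0 < q w -> (val w == y) = false.
  by rewrite /q; case: eqP.
have x0 : 0 < q x by exact: leq_ltn_trans l1.
have v0 : 0 < q v by exact: leq_ltn_trans l2.
have z0 : 0 < q z by exact: leq_ltn_trans l3.
have u0 : 0 < q u.
  by move: pg; rewrite (pos v) // (pos x) // (pos z) // !orbF /q; case: eqP.
have [eu uY] := qE _ u0; have [ev vY] := qE _ v0.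
have [ex xY] := qE _ x0; have [ez zY] := qE _ z0.
move: (nocross _ _ _ _ (And4 uY vY xY zY) uv xz) l1 l2 l3.
by rewrite eu ev ex ez !ltnS => /negP h l1 l2 l3; apply: h; rewrite l1 l2 l3.
Qed.

Lemma near_outerplanar_minors_apex (R : realType) n G :
  near_outerplanar n.+1 G -> minors_apex R n G.
Proof. by move=> hG H /near_outerplanar_minor/(_ hG)/near_outerplanar_apex. Qed.

(** * Adjacency matrices *)

Section LazyQuantifiers.
Variables (T : Type) (p : T -> bool).
(** Convertible to [has] and [all], but a search stops at the first success also
    under call-by-value evaluation. *)
Fixpoint lhas (s : seq T) :=
  if s is x :: s' then if p x then true else lhas s' else false.
Fixpoint lall (s : seq T) :=
  if s is x :: s' then if p x then lall s' else false else true.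
End LazyQuantifiers.

(** Rows may be shorter than the matrix; missing entries count as zeros. *)
Notation bitmatrix := (seq bitseq).

Definition mrow (g : bitmatrix) i : bitseq := nth [::] g i.

Definition madj (g : bitmatrix) i j := nth false (mrow g i) j.

Definition tab m (F : nat -> nat -> bool) : bitmatrix :=
  mkseq (fun i => mkseq (F i) m) m.

Definition bits (r : bitseq) : seq nat := mask r (iota 0 (size r)).

Definition nbrs (g : bitmatrix) v := bits (mrow g v).

Fixpoint weight (r : bitseq) :=
  if r is b :: r' then if b then (weight r').+1 else weight r' else 0.

Definition deg (g : bitmatrix) v := weight (mrow g v).

(** The vertex v stays, isolated, so that the other vertices keep their numbers. *)
Definition mdelete v (g : bitmatrix) : bitmatrix :=
  set_nth [::]
    [seq if nth false r v then set_nth false r v false else r | r <- g] v [::].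

Definition mdrop v (g : bitmatrix) :=
  tab (size g).-1 (fun i j => madj g (bump v i) (bump v j)).

Definition mset_edge u v b (g : bitmatrix) : bitmatrix :=
  let put x y h := set_nth [::] h x (set_nth false (mrow h x) y b) in
  put u v (put v u g).

Fixpoint orl (r s : bitseq) : bitseq :=
  match r, s with
  | [::], _ => s
  | _, [::] => r
  | b :: r', c :: s' => (b || c) :: orl r' s'
  end.

Fixpoint andl (r s : bitseq) : bitseq :=
  match r, s with
  | b :: r', c :: s' => (b && c) :: andl r' s'
  | _, _ => [::]
  end.

(** The merged vertex is u, and v stays as an isolated vertex. *)
Definition mcontract u v (g : bitmatrix) : bitmatrix :=
  let merge r := set_nth false (set_nth false r v false) u true in
  let ruv :=
    set_nth false (set_nth false (orl (mrow g u) (mrow g v)) u false) v false in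
  let rows := [seq if nth false r v then merge r else r | r <- g] in
  set_nth [::] (set_nth [::] rows v [::]) u ruv.

Lemma madj_default g i j : size g <= i -> madj g i j = false.
Proof. by move=> h; rewrite /madj /mrow [nth [::] _ _]nth_default // nth_nil. Qed.

Lemma madj_tab m F i j : madj (tab m F) i j = [&& i < m, j < m & F i j].
Proof.
rewrite /madj /mrow /tab; case: (ltnP i m) => hi /=; last first.
  by rewrite [nth [::] _ _]nth_default ?size_mkseq // nth_nil.
rewrite nth_mkseq //; case: (ltnP j m) => hj /=; last first.
  by rewrite nth_default ?size_mkseq.
by rewrite nth_mkseq.
Qed.

Lemma mrow_map F g i : F [::] = [::] -> mrow [seq F r | r <- g] i = F (mrow g i).
Proof.
move=> F0; rewrite /mrow; case: (ltnP i (size g)) => h; first exact: nth_map.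
by rewrite !nth_default ?size_map.
Qed.

Lemma mrow_set g i r j : mrow (set_nth [::] g i r) j = if j == i then r else mrow g j.
Proof. by rewrite /mrow nth_set_nth. Qed.

Lemma nth_bit_set r i b j :
  nth false (set_nth false r i b) j = if j == i then b else nth false r j.
Proof. by rewrite nth_set_nth. Qed.

Lemma madj_delete v g i j : madj (mdelete v g) i j = [&& madj g i j, i != v & j != v].
Proof.
rewrite /madj /mdelete mrow_set; case: eqP => /= _; first by rewrite ?nth_nil andbF.
rewrite mrow_map ?nth_nil //; case: ifP => [_|nv]; last first.
  by case: eqP => [->|_]; rewrite ?nv ?andbT.
by rewrite nth_bit_set; case: eqP => _; rewrite ?andbF ?andbT.
Qed.

Lemma madj_deletes X g i j :
  madj (foldr mdelete g X) i j = [&& madj g i j, i \notin X & j \notin X].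
Proof.
elim: X => [|x X IH] /=; first by rewrite !andbT.
rewrite madj_delete IH !inE !negb_or.
by case: (i == x); case: (j == x); rewrite /= ?andbF ?andbT.
Qed.

Lemma madj_set_edge u v b g i j : madj (mset_edge u v b g) i j =
  if ((i == u) && (j == v)) || ((i == v) && (j == u)) then b else madj g i j.
Proof.
rewrite /madj /mset_edge !mrow_set.
case: (eqVneq i u) => [->|iu] /=; rewrite ?nth_bit_set.
  case: (eqVneq j v) => [//|jv] /=; case: (eqVneq u v) => [uv|//] /=.
  by subst v; rewrite nth_bit_set.
by case: (eqVneq i v) => [->|iv] //=; rewrite nth_bit_set.
Qed.

Lemma size_mset_edge u v b g : u < size g -> v < size g ->
  size (mset_edge u v b g) = size g.
Proof.
by move=> us vs; rewrite /mset_edge !size_set_nth (maxn_idPr vs) (maxn_idPr us).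
Qed.

Lemma nth_orl r s i : nth false (orl r s) i = nth false r i || nth false s i.
Proof. by elim: r s i => [|b r IH] [|c s] [|i] //=; rewrite ?orbF ?nth_nil. Qed.

Lemma nth_andl r s i : nth false (andl r s) i = nth false r i && nth false s i.
Proof. by elim: r s i => [|b r IH] [|c s] [|i] //=; rewrite ?andbF ?nth_nil. Qed.

Lemma madj_contract u v g i j : u != v -> madj (mcontract u v g) i j =
  [&& i != v, j != v & if i == u then (j != u) && (madj g u j || madj g v j)
     else if j == u then madj g i u || madj g i v else madj g i j].
Proof.
move=> uv; rewrite /madj /mcontract mrow_set; case: (eqVneq i u) => [->|iu].
  rewrite !nth_bit_set nth_orl uv /=.
  by case: (j == v); case: (j == u).
rewrite mrow_set; case: (eqVneq i v) => [//|iv] /=; first by rewrite nth_nil.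
rewrite mrow_map ?nth_nil //; case: ifP => giv.
  rewrite !nth_bit_set ?giv orbT; case: (eqVneq j u) => [->|_]; first by rewrite uv.
  by case: (j == v).
rewrite ?giv orbF; case: (eqVneq j v) => [->|_] //=.
by case: (eqVneq j u) => [->|].
Qed.

Lemma mem_bits r i : (i \in bits r) = nth false r i.
Proof.
rewrite /bits in_mask ?iota_uniq // mem_iota /= add0n.
case: (ltnP i (size r)) => h; last by rewrite [RHS]nth_default.
have e : index i (iota 0 (size r)) = i.
  have {1}-> : i = nth 0 (iota 0 (size r)) i by rewrite nth_iota.
  by rewrite index_uniq ?size_iota ?iota_uniq.
by rewrite e.
Qed.

Lemma mem_nbrs g v i : (i \in nbrs g v) = madj g v i.
Proof. exact: mem_bits. Qed.

Lemma bits_uniq r : uniq (bits r).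
Proof. by rewrite /bits mask_uniq ?iota_uniq. Qed.

Lemma size_bits r : size (bits r) = weight r.
Proof.
rewrite /bits size_mask ?size_iota //.
by elim: r => //= -[] r ->.
Qed.

Definition simple_rel (a : rel nat) := symmetric a /\ irreflexive a.

Lemma delete_simple v g : simple_rel (madj g) -> simple_rel (madj (mdelete v g)).
Proof.
move=> [gs gi]; split=> [i j|i]; rewrite !madj_delete ?gi // gs.
by rewrite [(j != v) && _]andbC.
Qed.

Lemma deletes_simple X g : simple_rel (madj g) -> simple_rel (madj (foldr mdelete g X)).
Proof. by move=> sg; elim: X => //= x X IH; exact: delete_simple. Qed.

Lemma mset_edge_simple u v g :
  simple_rel (madj g) -> simple_rel (madj (mset_edge u v false g)).
Proof.
move=> [gs gi]; split=> [i j|i]; rewrite !madj_set_edge ?gi; last by case: ifP.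
by rewrite gs orbC ![(i == _) && _]andbC.
Qed.

Lemma drop_simple v g : simple_rel (madj g) -> simple_rel (madj (mdrop v g)).
Proof.
move=> [gs gi]; split=> [i j|i]; rewrite !madj_tab ?gi ?andbF //.
by rewrite gs andbCA.
Qed.

Lemma contract_simple u v g : u != v -> simple_rel (madj g) ->
  simple_rel (madj (mcontract u v g)).
Proof.
move=> uv [gs gi]; split=> [i j|i]; rewrite !madj_contract //; last first.
  by case: (eqVneq i u) => [->|]; rewrite ?eqxx ?gi ?andbF.
case: (eqVneq i u) => [->|iu]; case: (eqVneq j u) => [->|ju] //=.
- by rewrite andbCA ![madj g j _]gs.
- by rewrite andbCA ![madj g i _]gs.
- by rewrite andbCA gs.
Qed.

Definition well_formed (g : bitmatrix) :=
  let vs := iota 0 (size g) in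
  lall (fun i => [&& size (mrow g i) <= size g, 0 < deg g i, ~~ madj g i i &
                     lall (fun j => eqb (madj g i j) (madj g j i)) vs]) vs.

Lemma well_formedP g : well_formed g ->
  simple_rel (madj g) /\ forall i, i < size g -> exists j, madj g i j.
Proof.
move=> /allP wf; have {}wf i : i < size g -> [/\ size (mrow g i) <= size g,
    0 < deg g i, madj g i i = false & forall j, j < size g -> madj g i j = madj g j i].
  move=> ig; have /wf/and4P[-> -> /negbTE-> /allP h] : i \in iota 0 (size g).
    by rewrite mem_iota.
  by split=> // j jg; apply/eqP/h; rewrite mem_iota.
have big i j : madj g i j -> i < size g /\ j < size g.
  move=> ij; have ig : i < size g.
    by rewrite ltnNge; apply/negP => h; rewrite madj_default in ij.
  split=> //; have [ri _ _ _] := wf i ig; apply: leq_trans ri.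
  by rewrite ltnNge; apply/negP => h; rewrite /madj nth_default in ij.
split; last first.
  move=> i /wf[_ + _ _]; rewrite /deg -size_bits -/(nbrs g i).
  case E: (nbrs g i) => [//|j s] _; exists j.
  by rewrite -mem_nbrs E mem_head.
split=> [i j|i]; last first.
  by apply/negP => ii; have [/wf[_ _]] := big _ _ ii; rewrite ii.
apply/idP/idP => h; have [l1 l2] := big _ _ h.
  by have [_ _ _ <-] := wf _ l1.
by have [_ _ _ ->] := wf _ l2.
Qed.

(** Surjectivity makes the matrix determine the graph up to isomorphism. *)
Definition models (g : bitmatrix) G := exists f : G -> nat,
  [/\ injective f, forall x, f x < size g, forall i, i < size g -> exists x, f x = i &
      forall x y, adj x y = madj g (f x) (f y)].

(** A one-sided variant, which suffices for properties inherited by subgraphs. *)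
Definition embeds (g : bitmatrix) G := exists f : G -> nat,
  [/\ injective f, forall x, f x < size g & forall x y, adj x y -> madj g (f x) (f y)].

Lemma models_iso g G H : iso G H -> models g G -> models g H.
Proof.
move=> /iso_sym[h [bh ha]] [f [fi fs fS fa]]; exists (f \o h); split.
- exact: inj_comp (bij_inj bh).
- by move=> x; exact: fs.
- move=> i /fS[x <-]; have [h' hK h'K] := bh; exists (h' x).
  by rewrite /= h'K.
- by move=> x y /=; rewrite -fa ha.
Qed.

Lemma embeds_subgraph g G H : models g G -> embeds g H -> subgraph H G.
Proof.
move=> [f [fi fs fS fa]] [h [hi hs ha]].
have /choice[e eE] : forall x : H, exists y : G, f y = h x by move=> x; exact/fS/hs.
exists e; split=> [x y exy|x y /ha]; first by apply: hi; rewrite -!eE exy.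
by rewrite fa !eE.
Qed.

Lemma embeds_contract g G (f : G -> nat) (u v : G) :
  adj u v -> injective f -> (forall x, f x < size g) ->
  (forall x y, adj x y = madj g (f x) (f y)) ->
  embeds (mdrop (f v) (mcontract (f u) (f v) g)) (contract u v).
Proof.
move=> uv fi fs fa.
have ne : u != v by apply: contraTneq uv => ->; rewrite adj_irr.
have fne : f u != f v by rewrite (inj_eq fi).
have vne (x : contract u v) : f (val x) != f v by rewrite (inj_eq fi); exact: valP x.
have sc : size (mcontract (f u) (f v) g) = size g.
  by rewrite /mcontract !size_set_nth size_map !(maxn_idPr _) ?fs.
have small (x : contract u v) : unbump (f v) (f (val x)) < (size g).-1.
  have := fs (val x); have := fs v; have := vne x; rewrite /unbump; lia.
exists (fun x => unbump (f v) (f (val x))); split.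
- by move=> x y e; apply/val_inj/fi; rewrite -(unbumpK (vne x)) e unbumpK // inE vne.
- by move=> x; rewrite /mdrop size_mkseq sc.
move=> x y /andP[xy h]; rewrite madj_tab !sc !small !unbumpK ?inE ?vne //=.
rewrite madj_contract // !vne /= !(inj_eq fi).
move: h; rewrite -!fa; case: (eqVneq (val x) u) => [xu|xu] /=.
  have /negbTE yu : val y != u.
    by apply: contra xy => /eqP yu; apply/eqP/val_inj; rewrite xu yu.
  by rewrite xu yu /= orbF.
case: (eqVneq (val y) u) => [->|yu] /=; last by rewrite orbF.
by rewrite [adj v _]adj_sym.
Qed.

(** * Searching for K_5 and K_{3,3} minors *)

(** One pass over the rows: a vertex v of least positive degree d, the number of
    vertices that are not isolated, and the sum of the degrees. *)
Fixpoint survey (g : bitmatrix) i v d alive total :=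
  if g is r :: g' then
    let d' := weight r in
    if d' is 0 then survey g' i.+1 v d alive total else
    if d' < d then survey g' i.+1 i d' alive.+1 (d' + total)
    else survey g' i.+1 v d alive.+1 (d' + total)
  else (v, d, alive, total).

Fixpoint lhas_pair (p : bitseq -> bitseq -> bool) (l : seq bitseq) : bool :=
  if l is x :: l' then if lhas (p x) l' then true else lhas_pair p l' else false.

(** K_{3,3} as a subgraph: v and two further vertices have three common neighbours. *)
Definition has_K33 (g : bitmatrix) v :=
  lhas_pair (fun r s => 2 < weight (andl r s))
    [seq andl (mrow g v) r | r <- set_nth [::] g v [::]].

Definition has_K5 (g : bitmatrix) :=
  let s := [seq i <- iota 0 (size g) | 0 < deg g i] in
  if size s == 5 then lall (fun i => lall (fun j => eqn i j || madj g i j) s) s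
  else false.

Fixpoint insert_key (x : nat * (nat * nat)) s :=
  if s is y :: s' then if x.1 <= y.1 then x :: s else y :: insert_key x s' else [:: x].

(** Contracting an edge loses one edge for each common neighbour of its ends, so the
    edges with few common neighbours are tried first, preferably those whose ends
    have small degrees.  The factor 4 balances the two criteria. *)
Definition sorted_edges (g : bitmatrix) :=
  let key u w := 4 * weight (andl (mrow g u) (mrow g w)) + (deg g u + deg g w) in
  let insert u w l := if u < w then insert_key (key u w, (u, w)) l else l in
  foldr (fun u l => foldr (insert u) l (nbrs g u)) [::] (iota 0 (size g)).

(** The pruning by the number of edges is based on the cyclomatic number: a minor
    of a connected graph with p vertices and q edges does not have a larger value of
    q - p, and q - p is 3 for K_{3,3} and 5 for K_5.  A vertex of degree at most 2
    may be contracted into a neighbour.  Only the soundness of the search matters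
    for the proof. *)
Fixpoint kuratowski_minor fuel (g : bitmatrix) : bool :=
  if fuel is fuel'.+1 then
    let: (v, d, alive, total) := survey g 0 0 100 0 0 in
    if total < 2 * (alive + 3) then false else
    if d <= 2 then
      if nbrs g v is w :: _ then kuratowski_minor fuel' (mcontract w v g) else false
    else if if alive <= 6 then if has_K33 g v then true else has_K5 g else false
    then true
    else if if alive <= 6 then total < 22 else false then false
    else lhas (fun e => let: (u, w) := e.2 in
           if madj g w u then kuratowski_minor fuel' (mcontract w u g) else false)
         (sorted_edges g)
  else false.

Lemma z2planar_mcontract u v g : simple_rel (madj g) -> madj g u v ->
  z2planar (madj g) -> z2planar (madj (mcontract u v g)).
Proof.
move=> sg uv; have [gs gi] := sg.
have ne : u != v by apply: contraTneq uv => ->; rewrite gi.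
apply: (z2planar_contract uv gs) => x y.
have [_ ci] := contract_simple ne sg.
move=> h; have xy : x != y by apply: contraTneq h => ->; rewrite ci.
move: h; rewrite madj_contract // => /and3P[xv yv h]; split=> //.
move: h; case: (eqVneq x u) => [->|xu] /=.
  by case/andP => _ /orP[h|h]; [constructor 1|constructor 2].
case: (eqVneq y u) => [->|yu]; last by constructor 1.
by case/orP=> h; [constructor 1|constructor 3; rewrite gs].
Qed.

Lemma lhas_pairP p l : lhas_pair p l ->
  exists i j, [/\ i < j, j < size l & p (nth [::] l i) (nth [::] l j)].
Proof.
elim: l => // x l IH /=; case: ifP => [h _|_ /IH[i [j [ij jl pij]]]]; last first.
  by exists i.+1, j.+1.
have /hasP[_ /(nthP [::])[j jl <-] pxj] : has (p x) l by [].
by exists 0, j.+1.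
Qed.

Lemma three_bits r : 2 < weight r -> exists p1 p2 p3,
  [/\ nth false r p1, nth false r p2, nth false r p3 & uniq [:: p1; p2; p3]].
Proof.
rewrite -size_bits; have := mem_bits r; have := bits_uniq r.
case: (bits r) => [|p1 [|p2 [|p3 s]]] //= u m _; exists p1, p2, p3.
rewrite -!m !inE !eqxx ?orbT; split=> //.
move: u; rewrite !inE !negb_or => /and4P[/and3P[-> -> _] /andP[-> _] _ _] //.
Qed.

Lemma has_K33P g v : simple_rel (madj g) -> has_K33 g v -> ~ z2planar (madj g).
Proof.
move=> [gs gi] /lhas_pairP[i [j [ij]]]; set g' := set_nth [::] g v [::].
rewrite size_map => js; rewrite !(nth_map [::]) ?(ltn_trans ij) // => /three_bits.
have rowE k p : nth false (andl (mrow g v) (nth [::] g' k)) p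
    = [&& madj g v p, k != v & madj g k p].
  rewrite nth_andl -/(mrow g' k) mrow_set.
  by case: (eqVneq k v) => _; rewrite ?nth_nil ?andbF.
move=> [p1 [p2 [p3 []]]]; rewrite !(nth_andl _ (andl _ _)) !rowE.
move=> /and3P[/and3P[v1 iv i1] _ /andP[jv j1]] /and3P[/and3P[v2 _ i2] _ /andP[_ j2]].
move=> /and3P[/and3P[v3 _ i3] _ /andP[_ j3]] up.
have ne x y : madj g x y -> x != y by apply: contraTneq => ->; rewrite gi.
pose s := [:: v; i; j; p1; p2; p3].
have us : uniq s.
  rewrite /s /= !inE !negb_or (ne _ _ v1) (ne _ _ v2) (ne _ _ v3).
  rewrite (ne _ _ i1) (ne _ _ i2) (ne _ _ i3) (ne _ _ j1) (ne _ _ j2) (ne _ _ j3).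
  rewrite ![v == _]eq_sym iv jv (ltn_eqF ij) /=.
  by move: up; rewrite /= !inE negb_or.
apply: (@K33_not_z2planar _ _ (nth 0 s)).
  by move=> x y; rewrite !inE => hx hy /eqP; rewrite nth_uniq // => /eqP.
by move=> [|[|[|x]]] [|[|[|[|[|[|y]]]]]].
Qed.

Lemma has_K5P g : has_K5 g -> ~ z2planar (madj g).
Proof.
rewrite /has_K5; set s := [seq i <- _ | _]; case: ifP => // /eqP s5 /allP h.
have us : uniq s by rewrite filter_uniq ?iota_uniq.
apply: (@K5_not_z2planar _ _ (nth 0 s)).
  by move=> x y; rewrite !inE => hx hy /eqP; rewrite nth_uniq ?s5 // => /eqP.
move=> x y hx hy xy.
have /h/allP/(_ (nth 0 s y)) : nth 0 s x \in s by rewrite mem_nth ?s5.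
rewrite mem_nth ?s5 // => /(_ isT)/orP[] //; rewrite -[eqn _ _]/(_ == _).
by rewrite nth_uniq ?s5 // (negbTE xy).
Qed.

Lemma kuratowski_minorP fuel g :
  simple_rel (madj g) -> kuratowski_minor fuel g -> ~ z2planar (madj g).
Proof.
elim: fuel g => //= fuel IH g sg; have [gs gi] := sg.
have contr u v : madj g u v -> kuratowski_minor fuel (mcontract u v g) ->
    ~ z2planar (madj g).
  move=> uv h z; apply: (IH _ _ h (z2planar_mcontract sg uv z)).
  by apply: contract_simple => //; apply: contraTneq uv => ->; rewrite gi.
case: (survey _ _ _ _ _ _) => [[[v d] alive] total].
case: ifP => // _; case: ifP => [_|_].
  case E: (nbrs g v) => [//|w l]; apply: contr.
  by rewrite gs -mem_nbrs E mem_head.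
case: ifP => [|_ ].
  case: ifP => // _; case: ifP => [h _ _|_ h _]; [exact: (has_K33P sg h)|exact: has_K5P].
case: ifP => // _ /hasP[[k [u w]] _ /=].
by case: ifP => // wu; exact: contr.
Qed.

Fixpoint subs (T : Type) k (s : seq T) : seq (seq T) :=
  match k, s with
  | 0, _ => [:: [::]]
  | _.+1, [::] => [::]
  | k'.+1, x :: s' => [seq x :: y | y <- subs k' s'] ++ subs k s'
  end.

Lemma subs_size (T : Type) k (s : seq T) : all (fun y => size y == k) (subs k s).
Proof.
elim: s k => [|x s IH] [|k] //=; rewrite all_cat all_map IH andbT.
by rewrite -(@eq_all _ (fun y => size y == k)).
Qed.

(** It is enough to test deletions of exactly k vertices. *)
Lemma subs_cover (T : eqType) k (s A : seq T) : uniq s -> uniq A ->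
  {subset A <= s} -> size A <= k -> k <= size s ->
  exists2 Y, Y \in subs k s & {subset A <= Y}.
Proof.
elim: s k A => [|x s IH] [|k] A us uA As Ak ks.
- by exists [::]; rewrite ?inE // => y /As.
- by [].
- by exists [::]; rewrite ?inE // => y; move: Ak; case: (A).
move: us => /= /andP[xs us].
have [xA|xA] := boolP (x \in A).
  have [||z zA|||Y Yk AY] := IH k (rem x A).
  - by [].
  - exact: rem_uniq.
  - have : z \in A := mem_rem zA.
    move=> /As; rewrite inE => /orP[/eqP zx|//].
    by move: zA; rewrite zx mem_rem_uniqF.
  - by rewrite size_rem // -ltnS prednK // lt0n size_eq0; case: (A) xA.
  - by [].
  exists (x :: Y); first by rewrite /= mem_cat map_f.
  move=> z zA; rewrite inE; case: eqVneq => //= zx; apply: AY.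
  by rewrite mem_rem_uniq // inE zx.
have {}As : {subset A <= s}.
  move=> z zA; have := As z zA; rewrite inE => /orP[/eqP zx|//].
  by move: xA; rewrite -zx zA.
have [ks'|sk] := leqP k.+1 (size s).
  have [Y Yk AY] := IH k.+1 A us uA As Ak ks'.
  by exists Y => //; rewrite /= mem_cat Yk orbT.
have [//|//|//|||Y Yk AY] := IH k A.
- exact: leq_trans (uniq_leq_size uA As) sk.
- by [].
exists (x :: Y); first by rewrite /= mem_cat map_f.
by move=> z zA; rewrite inE AY ?orbT.
Qed.

(** The numbers that name no vertex are compared in the usual order; they are
    isolated, so that only antisymmetry has to hold for them. *)
Lemma z2planar_image G (f : G -> nat) : injective f -> z2planar (@adj G) ->
  z2planar (fun i j : nat => [exists x, [exists y, [&& f x == i, f y == j & adj x y]]]).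
Proof.
move=> fi [k [h [hA hk]]].
pose inv i := [pick x | f x == i].
have invE x : inv (f x) = Some x.
  by rewrite /inv; case: pickP => [y /eqP/fi -> //|/(_ x)]; rewrite eqxx.
pose k' w u v :=
  if (inv w, inv u, inv v) is (Some x, Some y, Some z) then k x y z else false.
pose h' u w := if (inv u, inv w) is (Some x, Some y) then h x y else u < w.
exists k', h'; split.
  move=> i j ij; rewrite /h'.
  have D : (i < j) = ~~ (j < i) by rewrite -leqNgt ltn_neqAle ij.
  rewrite /inv; case: pickP => [x /eqP xi|_]; case: pickP => [y /eqP yj|_] //.
  by apply: hA; apply: contra ij => /eqP xy; rewrite -xi -yj xy.
move=> i j p q /existsP[u /existsP[v /and3P[/eqP <- /eqP <- uv]]].
move=> /existsP[x /existsP[y /and3P[/eqP <- /eqP <- xy]]].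
rewrite !(inj_eq fi) /k' /h' !invE => *; exact: hk.
Qed.

Definition not_apex n (g : bitmatrix) :=
  lall (fun X => kuratowski_minor (size g) (foldr mdelete g X))
    (subs n (iota 0 (size g))).

Lemma not_apexP (R : realType) n g G : models g G -> simple_rel (madj g) ->
  n <= size g -> not_apex n g -> ~ n_apex R n G.
Proof.
move=> [f [fi fs fS fa]] sg ng /allP chk [X [cX /planar_z2planar pX]].
have [|||||Y YS XY] := @subs_cover _ n (iota 0 (size g)) [seq f x | x in X].
- exact: iota_uniq.
- by rewrite map_inj_uniq ?enum_uniq.
- by move=> _ /mapP[x _ ->]; rewrite mem_iota fs.
- by rewrite size_map -cardE.
- by rewrite size_iota.
have := chk Y YS; apply/negP/negP => /kuratowski_minorP; apply.
  exact: deletes_simple.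
have inj : injective (f \o val : del X -> nat) := inj_comp fi val_inj.
apply: z2planar_sub (z2planar_image inj pX) => i j.
rewrite madj_deletes => /and3P[ij iY jY].
have [gs gi] := sg.
have si : i < size g by rewrite ltnNge; apply/negP => h; rewrite madj_default in ij.
have sj : j < size g by rewrite ltnNge; apply/negP => h; rewrite gs madj_default in ij.
have [x xi] := fS i si; have [y yj] := fS j sj; subst i j.
have nX z : f z \notin Y -> z \notin X.
  by apply: contra => zX; apply: XY; rewrite map_f // mem_enum.
apply/existsP; exists (exist _ x (nX _ iY) : del X); apply/existsP.
by exists (exist _ y (nX _ jY) : del X); rewrite /= !eqxx /= /del_adj /= fa.
Qed.

(** * Searching for outerplanar orders *)

(** With x before [pre] and [pre] before t on the line, and r the row of x: no edge
    joins the gap below a chord that starts at x to the part of t beyond the chord.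
    An edge leaving a gap to the left is detected at its own left end. *)
Fixpoint gaps_separated (g : bitmatrix) (r : bitseq) (pre t : seq nat) : bool :=
  if t is y :: t' then
    if if nth false r y
       then lall (fun p => lall (fun q => ~~ madj g p q) t') pre else true
    then gaps_separated g r (y :: pre) t' else false
  else true.

Fixpoint noncrossing (g : bitmatrix) (s : seq nat) : bool :=
  if s is x :: t then
    if gaps_separated g (mrow g x) [::] t then noncrossing g t else false
  else true.

Fixpoint insert_after v a (s : seq nat) :=
  if s is x :: s' then
    if eqn x a then x :: v :: s' else x :: insert_after v a s'
  else [:: v].

Fixpoint insert_before v a (s : seq nat) :=
  if s is x :: s' then
    if eqn x a then v :: s else x :: insert_before v a s'
  else [:: v].

Fixpoint insert_between v a b x (s : seq nat) : option (seq nat) :=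
  if s is y :: s' then
    if (eqn x a && eqn y b) || (eqn x b && eqn y a) then Some (x :: v :: s)
    else omap (cons x) (insert_between v a b y s')
  else None.

(** A vertex v of degree 2 with neighbours a and b goes between them if they are
    neighbours on the line, cyclically; otherwise the four places next to a or b
    are tried. *)
Definition insert_ear (g : bitmatrix) v a b s :=
  if s is x :: s' then
    if insert_between v a b x s' is Some t then t else
    if (eqn x a && eqn (last x s') b) || (eqn x b && eqn (last x s') a) then v :: s
    else
      let candidates := [:: insert_after v a s; insert_before v a s;
                            insert_after v b s; insert_before v b s] in
      head s [seq t <- candidates | noncrossing g t]
  else [:: v].

(** Vertices of degree at most 1 have priority over those of degree 2. *)
Fixpoint find_small (g : bitmatrix) (vs : seq nat) (o : option nat) :=
  if vs is v :: vs' then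
    match deg g v with
    | 0 | 1 => Some v
    | 2 => find_small g vs' (if o is None then Some v else o)
    | _ => find_small g vs' o
    end
  else o.

(** An outerplanar graph has a vertex of degree at most 2.  Remove it, join its
    two neighbours, order the rest and insert it.  The result is only a guess,
    which [noncrossing] verifies. *)
Fixpoint outer_order fuel (g : bitmatrix) (vs : seq nat) : option (seq nat) :=
  if vs is [::] then Some [::] else
  if fuel is fuel'.+1 then
    match find_small g vs None with
    | None => None
    | Some v =>
      let vs' := [seq x <- vs | ~~ eqn x v] in
      match nbrs g v with
      | [::] => omap (cons v) (outer_order fuel' g vs')
      | [:: a] => omap (insert_after v a) (outer_order fuel' (mdelete v g) vs')
      | a :: b :: _ => omap (insert_ear g v a b)
          (outer_order fuel' (mset_edge a b true (mdelete v g)) vs')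
      end
    end
  else None.

Definition outer_test (g : bitmatrix) (Y : seq nat) :=
  let h := foldr mdelete g Y in
  let vs := [seq i <- iota 0 (size g) | ~~ has (eqn i) Y] in
  if outer_order (size g) h vs is Some s then
    if lall (fun i => has (eqn i) s) vs then noncrossing h s else false
  else false.

Fixpoint insert_deg (g : bitmatrix) v s :=
  if s is x :: s' then
    if deg g x <= deg g v then v :: s else x :: insert_deg g v s'
  else [:: v].

Definition by_degree (g : bitmatrix) := foldr (insert_deg g) [::] (iota 0 (size g)).

Definition near_outer k (g : bitmatrix) := lhas (outer_test g) (subs k (by_degree g)).

Lemma gaps_separatedP g r pre t : gaps_separated g r pre t ->
  forall t1 y t2, t = t1 ++ y :: t2 ->
  nth false r y -> {in t1 & t2, forall p q, ~~ madj g p q} /\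
                   {in pre & t2, forall p q, ~~ madj g p q}.
Proof.
elim: t pre => [|z t IH] pre /= h [|x t1] y t2 //= [e1 e2] ry; subst.
  move: h; rewrite ry; case: ifP => // /allP h _; split=> // p q pp qt.
  by have /allP := h p pp; apply.
move: h; case: ifP => // _ /IH/(_ t1 y t2 erefl ry)[h1 h2].
split=> p q; last by move=> pp; apply: h2; rewrite inE pp orbT.
by rewrite inE => /orP[/eqP ->|]; [apply: h2; rewrite inE eqxx|exact: h1].
Qed.

Lemma noncrossing_sorted g s a b c d :
  noncrossing g s -> madj g a b -> madj g c d -> d \in s ->
  ~~ [&& index a s < index c s, index c s < index b s & index b s < index d s].
Proof.
move=> + ab cd; elim: s => // x t IH /=; case: ifP => // h hn.
rewrite inE; have [_|dx] := eqVneq d x; first by rewrite !ltn0 !andbF.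
move=> /= dt; have [_|cx] := eqVneq c x; first by rewrite ltn0.
have [_|bx] := eqVneq b x; first by rewrite ltn0 andbF.
have [ax|ax] := eqVneq a x; last by rewrite !ltnS; exact: IH.
rewrite /= !ltnS; apply/negP => /andP[cb bd].
have bt : b \in t by rewrite -index_mem (ltn_trans bd) // index_mem.
have /(gaps_separatedP h)/(_ _)[|no _] :
    t = take (index b t) t ++ b :: drop (index b t).+1 t.
  by rewrite -{1}(cat_take_drop (index b t) t) (drop_nth b) ?index_mem // nth_index.
- by rewrite -/(madj g x b) -ax.
have hc : c \in take (index b t) t.
  by rewrite in_take_leq ?index_size.
have hd : d \in drop (index b t).+1 t.
  have dl : index d t < size t by rewrite index_mem.
  have {1}-> : d = nth d (drop (index b t).+1 t) (index d t - (index b t).+1).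
    by rewrite nth_drop subnKC // nth_index.
  by rewrite mem_nth // size_drop ltn_sub2r // (leq_ltn_trans bd dl).
by move/negP: (no c d hc hd).
Qed.

Lemma outer_testP k g Y H :
  size Y <= k -> outer_test g Y -> embeds g H -> near_outerplanar k H.
Proof.
rewrite /outer_test => Yk; case: outer_order => // s.
case: ifP => // /allP cover ncs [f [fi fs fa]].
have inS x : f x \notin Y -> f x \in s.
  move=> xY; have /cover/hasP[z zs /eqnP->] // :
    f x \in [seq i <- iota 0 (size g) | ~~ has (eqn i) Y].
  rewrite mem_filter mem_iota /= add0n fs andbT; apply/hasPn => z zY.
  by apply: contraNN xY => /eqnP ->.
exists [set x | f x \in Y], (fun x => index (f x) s); split.
- apply: leq_trans Yk; rewrite cardE -(size_map f); apply: uniq_leq_size.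
    by rewrite map_inj_uniq ?enum_uniq.
  by move=> _ /mapP[x + ->]; rewrite mem_enum inE.
- move=> x y; rewrite !inE => /inS xs /inS ys e; apply: fi.
  by rewrite -(nth_index 0 xs) e nth_index.
move=> u v x y; rewrite !inE => -[uY vY xY yY] uv xy ux uy vx vy.
pose e a b := [&& f a \notin Y, f b \notin Y & adj a b].
have es : symmetric e by move=> a b; rewrite /e adj_sym andbCA.
have ne a b : f a \notin Y -> f b \notin Y -> a != b -> index (f a) s != index (f b) s.
  move=> /inS ha /inS hb; apply: contra => /eqP ee; apply/eqP/fi.
  by rewrite -(nth_index 0 ha) ee nth_index.
apply: (between_sorted (e := e) (f := fun x => index (f x) s) es) => //;
  try exact: ne; rewrite /e ?uY ?xY ?vY ?yY //.
move=> a b c d /and3P[aY bY ab] /and3P[cY dY cd].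
by apply: (noncrossing_sorted ncs); rewrite ?madj_deletes ?fa ?aY ?bY ?cY ?dY // inS.
Qed.

Lemma near_outerP k g H : near_outer k g -> embeds g H -> near_outerplanar k H.
Proof.
move=> /hasP[Y Yk]; apply: outer_testP.
by have /allP/(_ Y Yk)/eqP -> := subs_size k (by_degree g).
Qed.

(** * Isomorphism of matrices *)

Fixpoint row_agree (r : bitseq) (p : seq nat) (q : bitseq) : bool :=
  match p, r with
  | [::], _ => true
  | j :: p', b :: r' => if eqb (nth false q j) b then row_agree r' p' q else false
  | _, _ => false
  end.

(** The list p holds the images of the rows already treated; an image of the next
    row must have the same degree and the same adjacencies to them. *)
Fixpoint iso_search (rows h : bitmatrix) p :=
  if rows is r :: rows' then
    lhas (fun j =>
        if if has (eqn j) p then false else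
           if eqn (weight r) (deg h j) then row_agree r p (mrow h j) else false
        then iso_search rows' h (rcons p j) else false) (iota 0 (size h))
  else true.

(** The numbers of vertices of degree 3, 4 and 5 tell most non-isomorphic graphs
    apart without a search. *)
Definition degree_counts (g : bitmatrix) :=
  let ds := [seq weight r | r <- g] in [seq count (eqn i) ds | i <- iota 3 3].

Definition miso (g h : bitmatrix) :=
  if eqn (size g) (size h) then
    if degree_counts g == degree_counts h then iso_search g h [::] else false
  else false.

Lemma row_agreeP r p q : row_agree r p q ->
  forall i, i < size p -> nth false r i = nth false q (nth 0 p i).
Proof.
elim: p r => // j p IH [|b r] //=; case: ifP => // /eqP qj /IH h [|i] //= ip.
exact: h.
Qed.

Lemma iso_searchP rows h p : uniq p -> all (gtn (size h)) p -> iso_search rows h p ->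
  exists q, [/\ size q = size rows, uniq (p ++ q), all (gtn (size h)) (p ++ q) &
    forall k i, k < size rows -> i < size p + k ->
      nth false (nth [::] rows k) i = madj h (nth 0 q k) (nth 0 (p ++ q) i)].
Proof.
elim: rows p => [|r rows IH] p up hp /=.
  by move=> _; exists [::]; rewrite cats0.
move=> /hasP[j]; rewrite mem_iota /= => jh.
case: ifP => //; case: ifP => //; case: ifP => // _ /negP jp /row_agreeP ra.
move=> srch; have [||q [sq uq hq agree]] := IH (rcons p j) _ _ srch.
- rewrite rcons_uniq up andbT; apply/negP => jin; apply: jp.
  by apply/hasP; exists j => //; rewrite -[eqn _ _]/(_ == _).
- by rewrite all_rcons hp /= jh.
exists (j :: q); rewrite -cat_rcons; split=> //=; first by rewrite sq.
move=> [|k] i kr ip /=.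
  rewrite addn0 in ip; rewrite ra //.
  by rewrite cat_rcons nth_cat ip.
by apply: agree; rewrite // size_rcons addSnnS.
Qed.

Lemma misoP g h : miso g h -> size g = size h /\ exists q,
  [/\ size q = size g, uniq q, all (gtn (size h)) q &
   forall k i, i < k -> k < size g -> madj g k i = madj h (nth 0 q k) (nth 0 q i)].
Proof.
rewrite /miso; case: ifP => // /eqP gh; case: ifP => // _.
move=> /iso_searchP[//|//|q [sq uq hq agree]].
by split=> //; exists q; split=> // k i ik kg; exact: agree.
Qed.

Section IsoTransfer.
Variables (g h : bitmatrix) (H : sgraph) (f : H -> nat) (q : seq nat).
Hypotheses (fi : injective f) (fs : forall x, f x < size g) (gh : size g = size h).
Hypotheses (sq : size q = size g) (uq : uniq q) (hq : all (gtn (size h)) q).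
Hypothesis agree : forall k i, i < k -> k < size g ->
   madj g k i = madj h (nth 0 q k) (nth 0 q i).
Let f' x := nth 0 q (f x).

Lemma iso_transfer_inj : injective f'.
Proof. by move=> x y /eqP; rewrite nth_uniq ?sq // => /eqP /fi. Qed.

Lemma iso_transfer_size x : f' x < size h.
Proof. by move/allP: hq; apply; rewrite mem_nth ?sq. Qed.

Lemma iso_transfer_adj x y :
  symmetric (madj h) -> madj g (f x) (f y) = madj g (f y) (f x) ->
  x != y -> madj g (f x) (f y) = madj h (f' x) (f' y).
Proof.
move=> hs gs xy; case: (ltngtP (f x) (f y)) => [l|l|/fi e].
- by rewrite gs hs; exact: agree.
- exact: agree.
- by rewrite e eqxx in xy.
Qed.

End IsoTransfer.

Lemma miso_embeds g h H :
  simple_rel (madj h) -> symmetric (madj g) -> irreflexive (madj g) ->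
  miso g h -> embeds g H -> embeds h H.
Proof.
move=> [hs hi] gs gi /misoP[gh [q [sq uq hq agree]]] [f [fi fs fa]].
exists (fun x => nth 0 q (f x)); split.
- exact: iso_transfer_inj sq uq.
- by move=> x; exact: (iso_transfer_size _ sq hq).
move=> x y /fa xy; rewrite -(iso_transfer_adj fi fs agree) //.
by apply: contraTneq xy => ->; rewrite gi.
Qed.

Lemma miso_models g h H : simple_rel (madj h) -> miso g h -> models g H -> models h H.
Proof.
move=> [hs hi] /misoP[gh [q [sq uq hq agree]]] [f [fi fs fS fa]].
exists (fun x => nth 0 q (f x)); split.
- exact: iso_transfer_inj sq uq.
- by move=> x; exact: (iso_transfer_size _ sq hq).
- move=> i ih.
  have qi : i \in q.
    have sub : {subset q <= iota 0 (size h)}.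
      by move=> z /(allP hq); rewrite mem_iota.
    have [] := uniq_min_size uq sub; first by rewrite size_iota sq gh.
    by move=> _ ->; rewrite mem_iota.
  have /fS[x xi] : index i q < size g by rewrite -sq index_mem.
  by exists x; rewrite xi nth_index.
move=> x y; have [->|xy] := eqVneq x y; first by rewrite adj_irr hi.
rewrite fa (iso_transfer_adj fi fs agree) //.
by rewrite -!fa adj_sym.
Qed.

(** * Generating the families *)

(** The list t names the three corners of the triangle; the new vertex gets the
    first free number. *)
Definition mtriY (g : bitmatrix) (t : seq nat) :=
  let m := size g in
  tab m.+1 (fun i j =>
    if eqn i m then has (eqn j) t else if eqn j m then has (eqn i) t else
    if madj g i j then ~~ (has (eqn i) t && has (eqn j) t) else false).

Definition mYtri (g : bitmatrix) v :=
  tab (size g).-1 (fun i j => let i' := bump v i in let j' := bump v j in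
    if madj g i' j' then true else if eqn i' j' then false else
    if madj g v i' then madj g v j' else false).

Definition mmoves (g : bitmatrix) :=
  flatten [seq flatten
    [seq [seq mtriY g [:: a; b; c]
           | c <- nbrs g a & if b < c then madj g b c else false]
      | b <- nbrs g a & a < b] | a <- iota 0 (size g)]
  ++ [seq mYtri g v | v <- iota 0 (size g) & eqn (deg g v) 3].

Lemma triY_models g G (f : G -> nat) (x y z : G) t : injective f ->
  (forall w, f w < size g) -> (forall i, i < size g -> exists w, f w = i) ->
  (forall u v, adj u v = madj g (f u) (f v)) ->
  all (gtn (size g)) t -> (forall w, (w \in [set x; y; z]%SET) = (f w \in t)) ->
  models (mtriY g t) (triY x y z).
Proof.
move=> fi fs fS fa ts ft.
have ht w : has (eqn (f w)) t = (w \in [set x; y; z]%SET).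
  rewrite ft; apply/hasP/idP => [[i it /eqnP->]|h] //.
  by exists (f w) => //; exact/eqnP.
have fne w : eqn (f w) (size g) = false by apply/eqP/eqP; rewrite ltn_eqF.
exists (fun w : triY x y z => if w is Some w then f w else size g); split.
- move=> [u|] [v|] //= => [/fi -> //|e|e]; first by have := fs u; rewrite e ltnn.
  by have := fs v; rewrite -e ltnn.
- by move=> [u|]; rewrite size_mkseq // ltnS ltnW.
- move=> i; rewrite size_mkseq ltnS leq_eqVlt => /predU1P[->|/fS[w <-]].
    by exists None.
  by exists (Some w).
have eqnn i : eqn i i by apply/eqnP.
move=> [u|] [v|] /=; rewrite madj_tab ?ltnS ?leqnn ?(ltnW (fs _)) /= ?fne ?eqnn ?ht //.
  by rewrite -fa; case: adj.
apply/esym/negP => /hasP[i /(allP ts) + /eqnP e].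
by rewrite -e /= ltnn.
Qed.

Lemma Ytri_models g G (v : G) (f : G -> nat) : injective f ->
  (forall w, f w < size g) -> (forall i, i < size g -> exists w, f w = i) ->
  (forall x y, adj x y = madj g (f x) (f y)) -> models (mYtri g (f v)) (Ytri v).
Proof.
move=> fi fs fS fa.
have vne (x : Ytri v) : f (val x) != f v by rewrite (inj_eq fi); exact: valP x.
have small (x : Ytri v) : unbump (f v) (f (val x)) < (size g).-1.
  have := fs (val x); have := fs v; have := vne x; rewrite /unbump; lia.
exists (fun x => unbump (f v) (f (val x))); split.
- by move=> x y e; apply/val_inj/fi; rewrite -(unbumpK (vne x)) e unbumpK // inE vne.
- by move=> x; rewrite size_mkseq.
- move=> i; rewrite size_mkseq => ig.
  have /fS[x xi] : bump (f v) i < size g by move: ig; rewrite /bump; case: leqP; lia.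
  have xv : x != v by rewrite -(inj_eq fi) xi eq_sym neq_bump.
  by exists (exist _ x xv : Ytri v); rewrite /= xi bumpK.
move=> x y; rewrite madj_tab !small !unbumpK ?inE ?vne //= -!fa.
rewrite /Ytri_adj -[eqn _ _]/(f (val x) == f (val y)) (inj_eq fi) (inj_eq val_inj).
by case: adj => //=; case: eqP.
Qed.

Lemma deg_models g G (f : G -> nat) v : injective f ->
  (forall i, i < size g -> exists w, f w = i) ->
  (forall x y, adj x y = madj g (f x) (f y)) ->
  (forall i j, madj g i j -> j < size g) ->
  deg g (f v) = #|[set x | adj v x]%SET|.
Proof.
move=> fi fS fa gj; rewrite /deg -size_bits -/(nbrs g (f v)).
rewrite cardE -(size_map f); apply/perm_size/uniq_perm; first exact: bits_uniq.
  by rewrite map_inj_uniq ?enum_uniq.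
move=> i; rewrite mem_nbrs; apply/idP/mapP => [h|[x + ->]].
  have [x xi] := fS _ (gj _ _ h); exists x => //.
  by rewrite mem_enum inE fa xi.
by rewrite mem_enum inE fa.
Qed.

Lemma mem_triangle g a b c : a < b -> b < c -> madj g a b -> madj g a c -> madj g b c ->
  mtriY g [:: a; b; c] \in mmoves g.
Proof.
move=> ab bc eab eac ebc; rewrite mem_cat; apply/orP; left.
apply/flatten_mapP; exists a.
  by rewrite mem_iota /= ltnNge; apply/negP => h; rewrite madj_default in eab.
apply/flatten_mapP; exists b; first by rewrite mem_filter ab mem_nbrs.
by apply: map_f; rewrite mem_filter bc ebc mem_nbrs.
Qed.

Lemma move_models g G K : simple_rel (madj g) -> models g G -> YDY_move G K ->
  exists2 h, h \in mmoves g & models h K.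
Proof.
move=> [gs gi] [f [fi fs fS fa]] [x y z xy yz xz|v dv]; last first.
  exists (mYtri g (f v)); last exact: Ytri_models.
  rewrite mem_cat; apply/orP; right; apply: map_f.
  rewrite mem_filter mem_iota fs andbT -[eqn _ _]/(_ == _).
  rewrite (deg_models _ fi fS fa) ?dv //.
  by move=> i j; rewrite gs ltnNge => h; apply/negP => ?; rewrite madj_default in h.
rewrite fa in xy; rewrite fa in yz; rewrite fa in xz.
have [yx zy zx] : [/\ madj g (f y) (f x), madj g (f z) (f y) & madj g (f z) (f x)].
  by rewrite gs xy gs yz gs xz.
suff [t tm tE] : exists2 t, mtriY g t \in mmoves g & t =i [:: f x; f y; f z].
  exists (mtriY g t) => //; apply: (triY_models fi fs fS fa).
    by apply/allP => i; rewrite tE !inE => /or3P[] /eqP ->; exact: fs.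
  by move=> w; rewrite tE !inE !(inj_eq fi) orbA.
have ne i j : madj g i j -> i != j by apply: contraTneq => ->; rewrite gi.
case: (ltngtP (f x) (f y)) => [lxy|lxy|e]; last by move: (ne _ _ xy); rewrite e eqxx.
  case: (ltngtP (f y) (f z)) => [lyz|lyz|e]; last by move: (ne _ _ yz); rewrite e eqxx.
    by exists [:: f x; f y; f z] => //; exact: mem_triangle.
  case: (ltngtP (f x) (f z)) => [lxz|lxz|e]; last by move: (ne _ _ xz); rewrite e eqxx.
    exists [:: f x; f z; f y]; first exact: mem_triangle.
    by move=> i; rewrite !inE; do 3!case: eqP.
  exists [:: f z; f x; f y]; first exact: mem_triangle.
  by move=> i; rewrite !inE; do 3!case: eqP.
case: (ltngtP (f x) (f z)) => [lxz|lxz|e]; last by move: (ne _ _ xz); rewrite e eqxx.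
  exists [:: f y; f x; f z]; first exact: mem_triangle.
  by move=> i; rewrite !inE; do 3!case: eqP.
case: (ltngtP (f y) (f z)) => [lyz|lyz|e]; last by move: (ne _ _ yz); rewrite e eqxx.
  exists [:: f y; f z; f x]; first exact: mem_triangle.
  by move=> i; rewrite !inE; do 3!case: eqP.
exists [:: f z; f y; f x]; first exact: mem_triangle.
by move=> i; rewrite !inE; do 3!case: eqP.
Qed.

(** Breadth-first closure under the moves up to isomorphism. *)
Fixpoint explore fuel (todo done : seq bitmatrix) : option (seq bitmatrix) :=
  match todo, fuel with
  | [::], _ => Some done
  | g :: todo', fuel'.+1 =>
    let add todo h := if lhas (miso h) (g :: done) then todo else
                      if lhas (miso h) todo then todo else rcons todo h in
    explore fuel' (foldl add todo' (mmoves g)) (g :: done)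
  | _, 0 => None
  end.

Definition known (L : seq bitmatrix) h := exists2 g, g \in L & h = g \/ miso h g.

Lemma known_sub L L' h : {subset L <= L'} -> known L h -> known L' h.
Proof. by move=> LL [g /LL gL' hg]; exists g. Qed.

Lemma exploreP fuel todo done L : explore fuel todo done = Some L ->
  {subset todo <= L} /\ {subset done <= L} /\
  forall g, g \in L -> g \in done \/ forall h, h \in mmoves g -> known L h.
Proof.
elim: fuel todo done => [|fuel IH] [|g todo] done //=.
- by case=> <-; split=> //; split=> // g gd; left.
- by case=> <-; split=> //; split=> // g gd; left.
set add := (fun (_ : seq bitmatrix) (_ : bitmatrix) => _).
have addP ms acc : {subset acc <= foldl add acc ms} /\
    forall h, h \in ms -> known (g :: done ++ foldl add acc ms) h.
  elim: ms acc => [|m ms IHm] acc /=; first by split.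
  have [s1 s2] := IHm (add acc m).
  have sub : {subset acc <= add acc m}.
    move=> z zacc; rewrite /add; case: ifP => // _; case: ifP => // _.
    by rewrite mem_rcons inE zacc orbT.
  split=> [z /sub/s1 //|h]; rewrite inE => /predU1P[->|]; last exact: s2.
  have : known (g :: done ++ add acc m) m.
    rewrite /add; case: ifP => [h1|_].
      have /hasP[z zg mz] : has (miso m) (g :: done) := h1.
      by exists z; [rewrite -cat_cons mem_cat zg|right].
    case: ifP => [/hasP[z zacc mz]|_].
      by exists z; [rewrite inE mem_cat zacc !orbT|right].
    by exists m; [rewrite inE mem_cat mem_rcons mem_head !orbT|left].
  apply: known_sub => z; rewrite !inE !mem_cat => /or3P[->|->|/s1 ->]; rewrite ?orbT //.
have [sub kn] := addP (mmoves g) todo.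
move=> /IH[tL [dL cl]]; split=> [z|].
  by rewrite inE => /predU1P[->|/sub/tL //]; apply: dL; rewrite mem_head.
split=> [z zd|z /cl[|]]; first by apply: dL; rewrite inE zd orbT.
  rewrite inE => /predU1P[->|]; last by left.
  right=> h /kn; apply: known_sub => w; rewrite inE mem_cat.
  by case/or3P=> [wg|wd|/tL //]; apply: dL; rewrite inE ?wg ?wd ?orbT.
by right.
Qed.

Lemma family_models fuel g0 L G0 G : explore fuel [:: g0] [::] = Some L ->
  (forall g, g \in L -> simple_rel (madj g)) -> models g0 G0 -> YDY_family G0 G ->
  exists2 g, g \in L & models g G.
Proof.
move=> /exploreP[tL [_ cl]] sL m0; elim=> [H GH|H K M _ [g gL mg] st KM].
  by exists g0; [apply: tL; rewrite mem_head|exact: (models_iso GH m0)].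
have [h hm mh] := move_models (sL g gL) mg st.
have {cl}cl : forall h, h \in mmoves g -> known L h by case: (cl g gL).
have [g' g'L [e|hg']] := cl h hm.
  by exists g' => //; rewrite -e; exact: (models_iso KM mh).
exists g' => //; apply: (models_iso KM); exact: (miso_models (sL _ g'L) hg' mh).
Qed.

(** * The obstructions *)

(** After a contraction the isolated vertex v is dropped, so that the result can be
    compared with other graphs up to isomorphism. *)
Definition minors_ok (ok : bitmatrix -> bool) (g : bitmatrix) :=
  let edge_ok u v :=
    if ok (mset_edge u v false g) then ok (mdrop v (mcontract u v g)) else false in
  lall (fun u => lall (fun v => if u < v then edge_ok u v else true) (nbrs g u))
    (iota 0 (size g)).

Lemma minors_okP (R : realType) n (ok : bitmatrix -> bool) g G : models g G ->
  (forall h H, ok h -> simple_rel (madj h) -> embeds h H -> minors_apex R n H) ->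
  simple_rel (madj g) -> minors_ok ok g ->
  forall u v : G, adj u v ->
    minors_apex R n (del_edge u v) /\ minors_apex R n (contract u v).
Proof.
move=> [f [fi fs fS fa]] okP sg chk u v uv.
have [gs gi] := sg.
have ne : u != v by apply: contraTneq uv => ->; rewrite adj_irr.
have {}chk a b : a < b -> madj g a b ->
    ok (mset_edge a b false g) /\ ok (mdrop b (mcontract a b g)).
  move=> lab ab; have ag : a < size g.
    by rewrite ltnNge; apply/negP => h; rewrite madj_default in ab.
  have /allP/(_ a) := chk; rewrite mem_iota ag => /(_ isT)/allP/(_ b).
  by rewrite mem_nbrs ab lab => /(_ isT); case: ifP.
have ordered a b : adj a b -> f a < f b ->
    minors_apex R n (del_edge a b) /\ minors_apex R n (contract a b).
  move=> ab lab; have [] := chk _ _ lab; first by rewrite -fa.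
  move=> okd okc; split.
    apply: okP okd _ _; first exact: mset_edge_simple.
    exists f; split=> // x; first by rewrite size_mset_edge.
    by move=> y /andP[xy]; rewrite madj_set_edge !(inj_eq fi) -fa xy => /negbTE->.
  apply: okP okc _ _; last exact: embeds_contract.
  by apply/drop_simple/contract_simple; rewrite ?(ltn_eqF lab).
case: (ltngtP (f u) (f v)) => [l|l|/fi e]; first exact: ordered.
  have [] := ordered v u _ l; first by rewrite adj_sym.
  move=> hd hc; split; last exact: minors_apex_subgraph (contract_flip ne) hc.
  apply: minors_apex_subgraph hd; exists id; split=> // x y /andP[xy h].
  by apply/andP; split; rewrite // orbC.
by rewrite e eqxx in ne.
Qed.

Definition mcomplete m := tab m (fun i j => ~~ eqn i j).

Definition mmultipartite s :=
  tab (sumn s) (fun i j => ~~ eqn (reshape_index s i) (reshape_index s j)).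

Lemma complete_models n : models (mcomplete n) (complete n).
Proof.
exists (fun i : complete n => val (i : 'I_n)); split.
- exact: val_inj.
- by move=> i; rewrite size_mkseq ltn_ord.
- by move=> i; rewrite size_mkseq => h; exists (Ordinal h).
by move=> i j; rewrite madj_tab !ltn_ord.
Qed.

Lemma multipartite_models s : models (mmultipartite s) (complete_multipartite s).
Proof.
have small (x : complete_multipartite s) : tagged x < nth 0 s (tag x).
  by rewrite -[nth 0 s _](tnth_nth 0 (in_tuple s)) ltn_ord.
pose f (x : complete_multipartite s) := flatten_index s (tag x) (tagged x).
have fs x : f x < sumn s by apply: flatten_indexP.
exists f; split.
- move=> [i j] [i' j'] e; have := congr1 (reshape_index s) e.
  rewrite /f !flatten_indexKl ?small //= => /val_inj ii; subst i'.
  have := congr1 (reshape_offset s) e.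
  by rewrite /f !flatten_indexKr ?small //= => /val_inj ->.
- by move=> x; rewrite size_mkseq.
- move=> k; rewrite size_mkseq => ks.
  pose i := Ordinal (reshape_indexP ks).
  have jP : reshape_offset s k < tnth (in_tuple s) i.
    by rewrite (tnth_nth 0); exact: reshape_offsetP.
  exists (Tagged (fun i => 'I_(tnth (in_tuple s) i)) (Ordinal jP)).
  exact: reshape_indexK.
move=> x y; rewrite madj_tab !fs /= /f !flatten_indexKl ?small //.
Qed.

Definition mK332 := mmultipartite [:: 3; 3; 2].

(** The vertices 0, 1, 2 and 3, 4, 5 and 6, 7 are the parts of K_{3,3,2}, and 2 and 5
    are deleted.  In the octahedron that remains, opposite vertices are placed at
    distance 3 on the line; the edges between odd positions go to the second
    page. *)
Lemma mK332_apex (R : realType) G : models mK332 G -> n_apex R 2 G.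
Proof.
move=> [f [fi fs fS fa]].
exists [set x | f x \in [:: 2; 5]]; split.
  rewrite cardE -(size_map f); apply: (@uniq_leq_size _ _ [:: 2; 5]).
    by rewrite map_inj_uniq ?enum_uniq.
  by move=> _ /mapP[x + ->]; rewrite mem_enum inE.
(* 6 is a dummy value for the deleted vertices *)
pose pos i := nth 0 [:: 0; 3; 6; 1; 4; 6; 2; 5] i.
pose p (x : del [set x | f x \in [:: 2; 5]]) := pos (f (val x)).
have off (x : del [set x | f x \in [:: 2; 5]]) : f (val x) \in [:: 0; 1; 3; 4; 6; 7].
  have := valP x; have := fs (val x); rewrite inE.
  by move: (f (val x)) => [|[|[|[|[|[|[|[|]]]]]]]].
apply: (@book_planar _ _ p (fun x y => odd (p x) && odd (p y))); split.
- move=> x y e; apply/val_inj/fi; move: (off x) (off y) e; rewrite /p /pos.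
  move: (f (val x)) (f (val y)).
  by move=> [|[|[|[|[|[|[|[|//]]]]]]]] [|[|[|[|[|[|[|[|//]]]]]]]].
- by move=> x y; rewrite andbC.
move=> u v x y; rewrite /= /del_adj !fa /p => uv xy.
pose s := [:: 0; 1; 3; 4; 6; 7].
have chk : all (fun a => all (fun b => all (fun c => all (fun d =>
   [&& madj mK332 a b, madj mK332 c d &
    (odd (pos a) && odd (pos b)) == (odd (pos c) && odd (pos d))] ==>
   ~~ [&& pos a < pos c, pos c < pos b & pos b < pos d]) s) s) s) s.
  by vm_compute.
move=> /eqP e; have /allP/(_ _ (off v))/allP/(_ _ (off x))/allP/(_ _ (off y)) :=
  allP chk _ (off u).
by rewrite uv xy e.
Qed.

Lemma mK332_minors_apex (R : realType) H : embeds mK332 H -> minors_apex R 2 H.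
Proof.
have mK := multipartite_models [:: 3; 3; 2]; move=> /(embeds_subgraph mK) HK.
apply: (minors_apex_subgraph HK) => {H HK} M MK.
have [sK nK] : simple_rel (madj mK332) /\
    forall i, i < size mK332 -> exists j, madj mK332 i j.
  by apply: well_formedP; vm_compute.
have chk : minors_ok (near_outer 3) mK332 by vm_compute.
have noiso (x : complete_multipartite [:: 3; 3; 2]) : exists y, adj x y.
  have [f [fi fs fS fa]] := mK; have [j xj] := nK _ (fs x).
  have [y yj] : exists y, f y = j.
    by apply: fS; rewrite ltnNge; apply/negP => h; rewrite sK.1 madj_default in xj.
  by exists y; rewrite fa yj.
have near h H : near_outer 3 h -> simple_rel (madj h) -> embeds h H ->
    minors_apex R 2 H.
  by move=> nh _ hH; apply: near_outerplanar_minors_apex; exact: near_outerP nh hH.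
have step := minors_okP mK near sK chk.
have [KM|[u [v [uv m]]]|[u [v [uv m]]]] := minor_step noiso MK.
- exact: n_apex_subgraph (iso_subgraph (iso_sym KM)) (mK332_apex R mK).
- exact: (step u v uv).1.
- exact: (step u v uv).2.
Qed.

(** The exceptions are graphs all of whose minors are known to be n-apex for
    another reason than near-outerplanarity. *)
Definition obstruction_check n exceptions (g : bitmatrix) :=
  [&& well_formed g, n <= size g, not_apex n g &
     minors_ok (fun h => if near_outer n.+1 h then true
                         else lhas (miso h) exceptions) g].

Lemma obstruction_checkP (R : realType) n exceptions g G :
  (forall h, h \in exceptions -> simple_rel (madj h) /\
     forall H, embeds h H -> minors_apex R n H) ->
  obstruction_check n exceptions g -> models g G -> minor_minimal_not_apex R n G.
Proof.
move=> exc /and4P[/well_formedP[sg ng] nsz na mo] mG; split.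
  exact: not_apexP mG sg nsz na.
have okP h H : (if near_outer n.+1 h then true else lhas (miso h) exceptions) ->
    simple_rel (madj h) -> embeds h H -> minors_apex R n H.
  move=> ok [hs hi] hH; move: ok; case: ifP => [nh _|_ /hasP[k /exc[sk kP] hk]].
    by apply: near_outerplanar_minors_apex; exact: near_outerP nh hH.
  by apply: kP; exact: miso_embeds hk hH.
have step := minors_okP mG okP sg mo.
apply: proper_minors_apex => [x|u v /step[]//|u v /step[]//].
have [f [fi fs fS fa]] := mG; have [j xj] := ng _ (fs x).
have [y yj] : exists y, f y = j.
  by apply: fS; rewrite ltnNge; apply/negP => h; rewrite sg.1 madj_default in xj.
by exists y; rewrite fa yj.
Qed.

(** The fuel 100 exceeds the size of each of the families. *)
Definition family_check n exceptions g0 :=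
  if explore 100 [:: g0] [::] is Some L then lall (obstruction_check n exceptions) L
  else false.

Lemma family_checkP (R : realType) n exceptions g0 G0 G :
  (forall h, h \in exceptions -> simple_rel (madj h) /\
     forall H, embeds h H -> minors_apex R n H) ->
  family_check n exceptions g0 -> models g0 G0 -> YDY_family G0 G ->
  minor_minimal_not_apex R n G.
Proof.
move=> exc; rewrite /family_check; case E: explore => [L|//] /allP obs m0 fam.
have sL g : g \in L -> simple_rel (madj g).
  by move=> /obs/and4P[/well_formedP[]].
have [g gL mg] := family_models E sL m0 fam.
exact: obstruction_checkP exc (obs g gL) mg.
Qed.

Theorem proposition2 (R : realType) (n : nat) (hn : n = 1 \/ n = 2) :
  (forall G : sgraph, YDY_family (complete (n + 5)) G ->
     minor_minimal_not_apex R n G) /\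
  (forall G : sgraph,
     YDY_family (complete_multipartite ([:: 3; 3] ++ nseq n 1)) G ->
     minor_minimal_not_apex R n G).
Proof.
have exc1 h : h \in [::] -> simple_rel (madj h) /\
    forall H, embeds h H -> minors_apex R 1 H by [].
have exc2 h : h \in [:: mK332] -> simple_rel (madj h) /\
    forall H, embeds h H -> minors_apex R 2 H.
  rewrite inE => /eqP ->; split; last by move=> H; exact: mK332_minors_apex.
  by have [] := @well_formedP mK332 _; first by vm_compute.
case: hn => ->; split=> G.
- by apply: (family_checkP exc1) (complete_models _); vm_compute.
- by apply: (family_checkP exc1) (multipartite_models _); vm_compute.
- by apply: (family_checkP exc2) (complete_models _); vm_compute.
- by apply: (family_checkP exc2) (multipartite_models _); vm_compute.
Qed.
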